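(* Let $X$ be an infinite-dimensional Banach space, let $Y$ be a Banach space with no finite cotype, and let $1\le p<+\infty$. Then there exists a continuous linear operator from $X$ to $Y$ which fails to be $p$-summing.
   Context: Banach spaces are over $\mathbb{K}=\mathbb{R}$ or $\mathbb{C}$ (the same field for $X$ and $Y$). $X'$ is the topological dual of $X$. For $1\le p<+\infty$, $\ell_p(X)$ is the space of sequences $(x_j)_{j=1}^\infty$ in $X$ with $\sum_{j}\|x_j\|^p<\infty$, and $\ell_p^w(X)$ is the space of sequences $(x_j)_{j=1}^\infty$ in $X$ such that $(\varphi(x_j))_{j=1}^\infty\in\ell_p$ for every $\varphi\in X'$. A continuous linear operator $u\colon X\to Y$ is (absolutely) $p$-summing if $(u(x_j))_{j=1}^\infty\in\ell_p(Y)$ whenever $(x_j)_{j=1}^\infty\in\ell_p^w(X)$. A Banach space $Y$ has cotype $s$, $2\le s<\infty$, if there is $C\ge 0$ such that for all $n$ and $y_1,\dots,y_n\in Y$, $\left(\sum_{k=1}^n\|y_k\|^s\right)^{1/s}\le C\left(\int_0^1\left\|\sum_{k=1}^n r_k(t)y_k\right\|^2dt\right)^{1/2}$, where $(r_k)$ are the Rademacher functions. $Y$ has no finite cotype if it has cotype $s$ for no $2\le s<\infty$. *)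

(* Defs.v *)
From HB Require Import structures.
From mathcomp Require Import all_boot all_order all_algebra.
From mathcomp Require Import all_classical all_reals all_analysis.
From mathcomp Require Import complex.

Set Implicit Arguments.
Unset Strict Implicit.
Unset Printing Implicit Defensive.

Import Order.TTheory GRing.Theory Num.Theory.
Import numFieldNormedType.Exports.

Local Open Scope classical_set_scope.
Local Open Scope ring_scope.

Variant scalar_kind := RealScalars | ComplexScalars.

Definition scalars (R : realType) (k : scalar_kind) : numFieldType :=
  match k with
  | RealScalars => R
  | ComplexScalars => R[i]%C
  end.

Definition scalar_re (R : realType) (k : scalar_kind) : scalars R k -> R :=
  match k return scalars R k -> R with
  | RealScalars => fun a => a
  | ComplexScalars => fun a => complex.Re a
  end.

(* The library norm of a [normedModType K] takes its values in [K]. Over R[i]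
   it is a nonnegative complex number, hence real, and its real part is the
   usual real-valued norm. *)
Definition rnorm (R : realType) (k : scalar_kind)
    (V : normedModType (scalars R k)) (x : V) : R :=
  scalar_re `|x|.

Definition infinite_dimensional (K : fieldType) (V : lmodType K) : Prop :=
  ~ exists (n : nat) (e : 'I_n -> V),
      forall x : V, exists c : 'I_n -> K, x = \sum_(i < n) c i *: e i.

Definition ell (R : realType) (k : scalar_kind) (p : R)
    (V : normedModType (scalars R k)) : set (nat -> V) :=
  [set x | (\sum_(0 <= j <oo) (rnorm (x j) `^ p)%:E < +oo)%E].

(* [K^o] is the scalar field [K] seen as a normed space over itself, so
   [phi] ranges over the topological dual of [V]. *)
Definition weak_ell (R : realType) (k : scalar_kind) (p : R)
    (V : normedModType (scalars R k)) : set (nat -> V) :=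
  [set x | forall phi : {linear V -> (scalars R k)^o},
     continuous phi -> ell p (fun j => phi (x j))].

Definition p_summing (R : realType) (k : scalar_kind) (p : R)
    (X Y : normedModType (scalars R k)) (u : X -> Y) : Prop :=
  forall x : nat -> X, weak_ell p x -> ell p (fun j => u (x j)).

(* r_n(t) = sign (sin (2^n pi t)), for n >= 1. *)
Definition rademacher (R : realType) (n : nat) (t : R) : int :=
  sgz (sin (2 ^+ n * pi * t)).

(* The index i : 'I_n starts at 0, while Rademacher functions are numbered
   from 1. *)
Definition cotype (R : realType) (k : scalar_kind) (s : R)
    (Y : normedModType (scalars R k)) : Prop :=
  exists2 C : R, 0 <= C & forall (n : nat) (y : 'I_n -> Y),
    (\sum_(i < n) rnorm (y i) `^ s) `^ s^-1 <=
    C * (\int[@lebesgue_measure R]_(t in `[0, 1])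
           (rnorm (\sum_(i < n) (rademacher i.+1 t)%:~R *: y i)) ^+ 2)
        `^ (2^-1).

Definition no_finite_cotype (R : realType) (k : scalar_kind)
    (Y : normedModType (scalars R k)) : Prop :=
  forall s : R, 2 <= s -> ~ cotype s Y.

(* Main.v *)
Require Import Defs.
From HB Require Import structures.
From mathcomp Require Import all_boot all_order all_algebra.
From mathcomp Require Import perm zify ring lra.
From mathcomp Require Import all_classical all_reals all_analysis.
From mathcomp Require Import measurable_realfun complex.
Set Implicit Arguments.
Unset Strict Implicit.
Unset Printing Implicit Defensive.
Import Order.TTheory GRing.Theory Num.Theory.
Import numFieldNormedType.Exports.
Local Open Scope classical_set_scope.
Local Open Scope ring_scope.

(** The operator is built from finite-rank pieces, using one extreme property of
    each space.

    On the side of [X], the Dvoretzky-Rogers lemma [dvoretzky_rogers] gives, for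
    each [m], vectors [x_1, ..., x_m] with [1/4 <= |x_i| <= 1] and
    [|sum_i a_i x_i| <= (sum_i a_i^2)^(1/2)] for real [a_i]. Thus the sum of the
    [|phi (x_i)|] is at most of order [m^(1/2)] for each functional [phi] of norm
    one, while the sum of the [|x_i|^p] is of order [m]. These vectors come
    from an operator from a Euclidean space of dimension [2 m] to [X] that has
    norm at most one and an almost maximal determinant against fixed
    functionals: it cannot be small on any subspace of dimension larger than
    [m], since doubling it there would increase the determinant.

    On the side of [Y], the best constant [d_n] in the inequality
    [sum_i |y_i|^2 <= n d_n E |sum_i r_i y_i|^2] for [n] vectors is
    submultiplicative in [n]; for the powers of a number this is [gain_power]. If
    [d_n < 1] for some [n], then it decays like a negative power of the number of
    vectors, and [Y] has finite cotype ([gain_cotype]). Otherwise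
    there are [n] vectors for which this inequality, with constant one, is
    almost an equality, and then all the signed sums are comparable with the
    single vectors. So [Y] contains, for each [m], vectors [y_1, ..., y_m] with
    [1/2 <= |y_i|] and [|sum_i a_i y_i| <= 2] whenever all [|a_i| <= 1]
    ([no_cotype_bounded_combinations]).

    With functionals [phi_i] norming [x_i], the operators
    [x |-> sum_i e_i phi_i(x) y_i], where [e_i] is a sign, are uniformly bounded,
    and for a suitable choice of signs they are bounded below on half of the
    vectors [x_i], even after adding any given map ([block]). Such operators,
    with rapidly decreasing coefficients and with the signs of each one chosen
    after the preceding ones, are summed to the operator [u]; the vectors of all
    the blocks, rescaled, form a weakly [p]-summable sequence whose image under
    [u] is not [p]-summable.

    The geometric arguments only involve real coefficients. They are carried
    out in real vector spaces with a seminorm, and apply to complex spaces by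
    restriction of scalars ([realify]). *)

(** * The Hahn-Banach theorem *)

Section HahnBanach.
Variables (R : realType) (V : lmodType R).

(** Nonnegativity and the value zero at zero follow from these two laws. *)
Record seminorm (N : V -> R) : Prop := Seminorm {
  seminorm_ler : forall x y, N (x + y) <= N x + N y;
  seminormZ : forall a x, N (a *: x) = `|a| * N x }.

(** Real functionals are handled as plain functions with this property. *)
Definition real_linear (f : V -> R) : Prop :=
  forall a x y, f (a *: x + y) = a * f x + f y.

(** Subadditive and positively homogeneous: for positive scalars the stated
    inequality implies equality. *)
Definition sublinear (p : V -> R) : Prop :=
  (forall x y, p (x + y) <= p x + p y) /\
  (forall t x, 0 < t -> p (t *: x) <= t * p x).

Lemma seminorm_sublinear N : seminorm N -> sublinear N.
Proof.
by move=> [N1 N2]; split=> // t x t0; rewrite N2 gtr0_norm.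
Qed.

Lemma sublinear0 p : sublinear p -> p 0 = 0.
Proof.
move=> [p1 p2]; have h1 := p1 0 0; have h2 := p2 2^-1 0; move: h1 h2.
rewrite addr0 scaler0; set a := p 0 => h1 h2.
have {}h2 : a <= 2^-1 * a by apply: h2; rewrite invr_gt0.
lra.
Qed.

Lemma sublinearZ p t x : sublinear p -> 0 <= t -> p (t *: x) = t * p x.
Proof.
move=> sp; rewrite le_eqVlt => /predU1P[<-|t0].
  by rewrite scale0r sublinear0 // mul0r.
apply/eqP; rewrite eq_le (sp.2 _ _ t0) /=.
have ti : 0 < t^-1 by rewrite invr_gt0.
have := sp.2 t^-1 (t *: x) ti.
by rewrite scalerA mulVf ?gt_eqF // scale1r mulrC ler_pdivlMr // mulrC.
Qed.

Lemma sublinear_geN p x : sublinear p -> - p (- x) <= p x.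
Proof.
by move=> sp; have := sp.1 x (- x); rewrite subrr sublinear0 //; lra.
Qed.

(** Pointwise infima of suitably directed families stay sublinear: this covers
    both the infimum of a chain and the modification in [sublinear_shift]. *)
Lemma inf_sublinear (I : Type) (E : set I) (F : I -> V -> R) (b : V -> R) :
  E !=set0 -> (forall i x, E i -> b x <= F i x) ->
  (forall i j x y, E i -> E j ->
    exists2 k, E k & F k (x + y) <= F i x + F j y) ->
  (forall i t x, E i -> 0 < t -> exists2 k, E k & F k (t *: x) <= t * F i x) ->
  let q x := inf [set F i x | i in E] in
  sublinear q /\ forall i x, E i -> q x <= F i x.
Proof.
move=> [i0 Ei0] bF FD FZ q.
have lbF x : has_lbound [set F i x | i in E].
  by exists (b x) => _ [i Ei <-]; exact: bF.
have qF i x : E i -> q x <= F i x.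
  by move=> Ei; apply: ge_inf => //; exists i.
have infF x : has_inf [set F i x | i in E].
  by split => //; exists (F i0 x), i0.
split => //; split => [x y|t x t0]; apply/ler_addgt0Pl => e e0.
- have e2 : 0 < e / 2 by rewrite divr_gt0.
  have [_ [i Ei <-] hi] := inf_adherent e2 (infF x).
  have [_ [j Ej <-] hj] := inf_adherent e2 (infF y).
  have [k Ek hk] := FD i j x y Ei Ej.
  have := qF _ (x + y) Ek; rewrite -/(q x) -/(q y) in hi hj *.
  by move: (F i x) (F j y) (F k (x + y)) (q x) (q y) (q (x + y)) hi hj hk => *; lra.
- have e2 : 0 < e / t by rewrite divr_gt0.
  have [_ [i Ei <-] hi] := inf_adherent e2 (infF x).
  have [k Ek hk] := FZ i t x Ei t0.
  have := qF _ (t *: x) Ek; rewrite -/(q x) in hi *.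
  move: hi; rewrite -(ltr_pM2l t0) mulrDr mulrCA divff ?gt_eqF // mulr1.
  by move: (t * F i x) (F k (t *: x)) (t * q x) (q (t *: x)) hk => *; lra.
Qed.

(** Making a sublinear functional smaller so that it becomes odd at [y]. *)
Lemma sublinear_shift p y : sublinear p ->
  exists q, [/\ sublinear q, forall x, q x <= p x & q (- y) <= - p y].
Proof.
move=> sp.
pose F t x := p (x + t *: y) - t * p y.
have [] := @inf_sublinear R [set t | 0 <= t] F (fun x => - p (- x)).
- by exists 0 => /=.
- move=> t x /= t0; rewrite /F.
  have := sp.1 (x + t *: y) (- x).
  by rewrite addrAC subrr add0r sublinearZ //; lra.
- move=> s t x x' /= s0 t0; exists (s + t); first exact: addr_ge0.
  rewrite /F scalerDl addrACA; have := sp.1 (x + s *: y) (x' + t *: y); lra.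
- move=> s t x /= s0 t0; exists (t * s); first by rewrite /= mulr_ge0 // ltW.
  by rewrite /F -scalerA -scalerDr (sublinearZ _ sp (ltW t0)); lra.
set q := (fun x => _) => sq qF; exists q; split => // [x|].
  have := qF 0 x; rewrite /F scale0r addr0 mul0r subr0; apply.
  exact: lexx.
have := qF 1 (- y) ler01.
by rewrite /F scale1r addNr sublinear0 // mul1r sub0r.
Qed.

(** A minimal sublinear functional below [p] is linear: it agrees with each of
    its modifications by [sublinear_shift], so it is odd. *)
Theorem sublinear_minorant p : sublinear p ->
  exists2 f, real_linear f & forall x, f x <= p x.
Proof.
move=> sp.
pose T := {q : V -> R | sublinear q /\ forall x, q x <= p x}.
pose r (q1 q2 : T) := `[< forall x, sval q2 x <= sval q1 x >].
have [| | | |q qmin] := @Zorn T r.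
- by move=> q; apply/asboolP.
- move=> q1 q2 q3 /asboolP h1 /asboolP h2; apply/asboolP => x.
  exact: le_trans (h2 x) (h1 x).
- move=> [q1 p1] [q2 p2] /asboolP /= h1 /asboolP /= h2.
  apply/eq_exist/funext => x; apply/eqP; rewrite eq_le.
  by rewrite h1 h2.
- move=> A Atot; have [A0|/set0P/negP] := pselect (A !=set0); last first.
    rewrite negbK => /eqP ->; exists (exist _ p (conj sp (fun x => lexx _))).
    by move=> s [].
  have [] := @inf_sublinear T A (fun q => sval q) (fun x => - p (- x)) A0.
  + move=> q x Aq; have [sq qp] := svalP q.
    by apply: le_trans (sublinear_geN x sq); rewrite lerN2.
  + move=> q1 q2 x y A1 A2; have [h|h] := Atot _ _ A1 A2.
      exists q2 => //; apply: le_trans ((svalP q2).1.1 x y) _.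
      by rewrite lerD2r; move/asboolP: h.
    exists q1 => //; apply: le_trans ((svalP q1).1.1 x y) _.
    by rewrite lerD2l; move/asboolP: h.
  + by move=> q t x Aq t0; exists q => //; exact: (svalP q).1.2.
  set q := (fun x => _) => sq qA.
  have qp x : q x <= p x.
    have [q0 Aq0] := A0.
    exact: le_trans (qA _ _ Aq0) ((svalP q0).2 x).
  exists (exist _ q (conj sq qp)) => s As; apply/asboolP => x; exact: qA.
have [sq qp] := svalP q; set g := sval q in sq qp.
have odd y : g (- y) = - g y.
  apply/eqP; rewrite eq_le; apply/andP; split; last first.
    by have := sublinear_geN (- y) sq; rewrite opprK.
  have [q' [sq' q'g q'y]] := sublinear_shift y sq.
  have q'p x : q' x <= p x by apply: le_trans (q'g x) (qp x).
  have : r q (exist _ q' (conj sq' q'p)) by apply/asboolP.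
  by move=> /qmin /(congr1 sval) /= q'E; move: q'y; rewrite q'E.
have gD x y : g (x + y) = g x + g y.
  apply/eqP; rewrite eq_le sq.1 /=.
  by have := sq.1 (x + y) (- y); rewrite addrK odd; lra.
exists g => // a x y; rewrite gD; congr (_ + _).
have [a0|a0] := leP 0 a; first by rewrite sublinearZ.
rewrite -[a]opprK scaleNr odd sublinearZ ?mulNr //.
by rewrite oppr_ge0 ltW.
Qed.

(** A norming functional: shifting [N] at [x0] first forces [f x0 = N x0]. *)
Theorem hahn_banach N x0 : seminorm N ->
  exists f, [/\ real_linear f, forall x, `|f x| <= N x & f x0 = N x0].
Proof.
move=> sN; have [q [sq qN qx0]] := sublinear_shift x0 (seminorm_sublinear sN).
have [f lf fq] := sublinear_minorant sq.
have f0 : f 0 = 0 by have := lf 1 0 0; rewrite scaler0 addr0; lra.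
have fN x : f (- x) = - f x.
  by have := lf (-1) x 0; rewrite scaleN1r !addr0 f0; lra.
have fle x : f x <= N x by apply: le_trans (fq x) (qN x).
exists f; split => //.
- move=> x; rewrite ler_norml fle andbT lerNl -fN.
  apply: le_trans (fle _) _.
  by rewrite -scaleN1r (seminormZ sN) normrN1 mul1r.
- apply/eqP; rewrite eq_le fle /= -lerN2 -fN.
  exact: le_trans (fq _) qx0.
Qed.

End HahnBanach.

(** * The Dvoretzky-Rogers lemma *)

Section RealLinear.
Variables (R : realType) (V : lmodType R) (f : V -> R).
Hypothesis lf : real_linear f.

Lemma real_linear0 : f 0 = 0.
Proof. by have := lf 1 0 0; rewrite scaler0 addr0; lra. Qed.

Lemma real_linearD x y : f (x + y) = f x + f y.
Proof. by rewrite -{1}[x]scale1r lf mul1r. Qed.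

Lemma real_linearZ a x : f (a *: x) = a * f x.
Proof. by rewrite -{1}[a *: x]addr0 lf real_linear0 addr0. Qed.

Lemma real_linear_sum (I : Type) (r : seq I) (x : I -> V) :
  f (\sum_(i <- r) x i) = \sum_(i <- r) f (x i).
Proof. exact: (big_morph f real_linearD real_linear0). Qed.

End RealLinear.

Section Seminorm.
Variables (R : realType) (V : lmodType R) (N : V -> R).
Hypothesis sN : seminorm N.

Lemma seminorm0 : N 0 = 0.
Proof. by rewrite -(scale0r 0) (seminormZ sN) normr0 mul0r. Qed.

Lemma seminormN x : N (- x) = N x.
Proof. by rewrite -scaleN1r (seminormZ sN) normrN1 mul1r. Qed.

Lemma seminorm_ge0 x : 0 <= N x.
Proof.
by have := seminorm_ler sN x (- x); rewrite subrr seminorm0 seminormN; lra.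
Qed.

Lemma seminorm_sum (I : Type) (r : seq I) (x : I -> V) :
  N (\sum_(i <- r) x i) <= \sum_(i <- r) N (x i).
Proof.
elim: r => [|i r IHr]; first by rewrite !big_nil seminorm0.
by rewrite !big_cons; apply: le_trans (seminorm_ler sN _ _) _; rewrite lerD2l.
Qed.

Lemma seminorm_pair x y : 2 * N x <= N (y + x) + N (y - x).
Proof.
have := seminorm_ler sN (y + x) (- (y - x)).
rewrite seminormN opprB [y + x]addrC addrACA subrr addr0 -mulr2n -scaler_nat.
by rewrite (seminormZ sN) normr_nat [x + y]addrC.
Qed.

End Seminorm.

Section TriangularSystem.
Variables (R : realType) (V : lmodType R).
Hypothesis V_inf : infinite_dimensional V.

(** Finitely many linear functionals have a common kernel of finite
    codimension, so it is nonzero in an infinite-dimensional space. *)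
Lemma common_kernel (k : nat) (f : nat -> V -> R) :
  (forall j, (j < k)%N -> real_linear (f j)) ->
  exists2 x, x != 0 & forall j, (j < k)%N -> f j x = 0.
Proof.
move=> lf.
have [n [e he]] : exists (n : nat) (e : 'I_n -> V), forall x,
    exists c : 'I_n -> R, forall j, (j < k)%N ->
      f j (x - \sum_(i < n) c i *: e i) = 0.
  elim: k lf => [|k IHk] lf; first by exists 0, (fun=> 0) => x; exists (fun=> 0).
  have [n [e he]] := IHk (fun j jk => lf j (ltnW jk)).
  have lk := lf k (ltnSn k).
  have [h|] := pselect (forall v, (forall j, (j < k)%N -> f j v = 0) -> f k v = 0).
    exists n, e => x; have [c hc] := he x; exists c => j.
    by rewrite ltnS leq_eqVlt => /predU1P[->|]; [exact: h|exact: hc].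
  move=> /existsNP[v /not_implyP[hv fkv]].
  exists n.+1, (fun i => if unlift ord0 i is Some j then e j else v) => x.
  have [c hc] := he x.
  set y := x - _ in hc.
  exists (fun i => if unlift ord0 i is Some j then c j else f k y / f k v).
  move=> j; rewrite big_ord_recl /= unlift_none.
  under eq_bigr do rewrite liftK.
  have -> : x - (f k y / f k v *: v + \sum_(i < n) c i *: e i)
     = (- (f k y / f k v)) *: v + y.
    by rewrite /y scaleNr [RHS]addrC opprD addrAC addrA.
  rewrite ltnS leq_eqVlt => /predU1P[->|jk].
    by rewrite lk mulNr divfK ?addNr //; exact/eqP.
  by rewrite (lf j (ltnW jk)) (hv j jk) (hc j jk) mulr0 addr0.
apply: contrapT => h; apply: V_inf; exists n, e => x.
have [c hc] := he x; exists c.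
apply/eqP; rewrite -subr_eq0; apply/negPn/negP => x0.
by apply: h; exists (x - \sum_(i < n) c i *: e i).
Qed.

Variable N : V -> R.
Hypothesis sN : seminorm N.
Hypothesis N_eq0 : forall x, N x = 0 -> x = 0.

(** The matrix of the values [f i (z j)] is triangular and invertible. *)
Lemma triangular_system (n : nat) :
  exists (z : nat -> V) (f : nat -> V -> R), forall i, (i < n)%N ->
    [/\ real_linear (f i), forall x, `|f i x| <= N x, f i (z i) != 0 &
        forall j, (j < i)%N -> f j (z i) = 0].
Proof.
elim: n => [|n [z [f zf]]]; first by exists (fun=> 0), (fun _ _ => 0).
have [y y0 fy] : exists2 x, x != 0 & forall j, (j < n)%N -> f j x = 0.
  by apply: common_kernel => j /zf[].
have [g [lg gN gy]] := hahn_banach y sN.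
exists (fun i => if (i < n)%N then z i else y).
exists (fun i => if (i < n)%N then f i else g) => i.
rewrite ltnS leq_eqVlt => /predU1P[->|iN].
  rewrite ltnn; split => //.
    by rewrite gy; apply: contra_neq y0; exact: N_eq0.
  by move=> j jn; rewrite jn; exact: fy.
rewrite iN; have [h1 h2 h3 h4] := zf i iN; split => // j ji.
by rewrite (ltn_trans ji iN); exact: h4.
Qed.

End TriangularSystem.

Section DvoretzkyRogers.
Variables (R : realType) (V : lmodType R) (N : V -> R).
Hypothesis sN : seminorm N.

(** The squared Euclidean norm of a column vector, then the norm itself. *)
Definition sqnorm n (a : 'cV[R]_n) : R := (a^T *m a) 0 0.
Definition l2norm n (a : 'cV[R]_n) : R := Num.sqrt (sqnorm a).

Lemma sqnormE n (a : 'cV[R]_n) : sqnorm a = \sum_(i < n) a i 0 ^+ 2.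
Proof. by rewrite /sqnorm mxE; apply: eq_bigr => i _; rewrite mxE expr2. Qed.

Lemma sqnorm_ge0 n (a : 'cV[R]_n) : 0 <= sqnorm a.
Proof. by rewrite sqnormE sumr_ge0 // => i _; exact: sqr_ge0. Qed.

Lemma ler_l2norm n (a : 'cV[R]_n) i : `|a i 0| <= l2norm a.
Proof.
rewrite -sqrtr_sqr ler_wsqrtr // sqnormE (bigD1 i) //= lerDl.
by apply: sumr_ge0 => j _; exact: sqr_ge0.
Qed.

Lemma l2normZ n c (a : 'cV[R]_n) : l2norm (c *: a) = `|c| * l2norm a.
Proof.
rewrite /l2norm !sqnormE -sqrtr_sqr -sqrtrM ?sqr_ge0 // mulr_sumr.
by congr Num.sqrt; apply: eq_bigr => i _; rewrite mxE exprMn.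
Qed.

(** The operator from Euclidean space to [V] sending the basis to [x]. *)
Definition synth n (x : 'I_n -> V) (a : 'cV[R]_n) : V :=
  \sum_(i < n) a i 0 *: x i.

Lemma synthD n (x : 'I_n -> V) a b : synth x (a + b) = synth x a + synth x b.
Proof.
by rewrite /synth -big_split; apply: eq_bigr => i _ /=; rewrite mxE scalerDl.
Qed.

Lemma synthZ n (x : 'I_n -> V) c a : synth x (c *: a) = c *: synth x a.
Proof.
by rewrite /synth scaler_sumr; apply: eq_bigr => i _ /=; rewrite mxE scalerA.
Qed.

(** The tuple obtained by composing [synth x] with the matrix [B]. *)
Definition comp_mx n k (x : 'I_n -> V) (B : 'M[R]_(n, k)) (j : 'I_k) : V :=
  synth x (col j B).

Lemma synth_comp n k (x : 'I_n -> V) (B : 'M[R]_(n, k)) a :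
  synth (comp_mx x B) a = synth x (B *m a).
Proof.
rewrite /synth /comp_mx /synth.
under eq_bigr do rewrite scaler_sumr.
rewrite exchange_big /=; apply: eq_bigr => i _.
rewrite mxE scaler_suml; apply: eq_bigr => j _.
by rewrite mxE scalerA mulrC.
Qed.

(** The operator [synth x] has norm at most one. *)
Definition contractive n (x : 'I_n -> V) : Prop :=
  forall a, N (synth x a) <= l2norm a.

(** For orthonormal columns [E] the matrix [2 - E E^T] is the sum of the identity
    and the orthogonal projection onto the complement of these columns. Its
    determinant is computed from a block matrix with identity upper left
    corner, by eliminating either off-diagonal block. *)
Lemma det_compl_orthonormal n k (E : 'M[R]_(n, k)) : E^T *m E = 1%:M ->
  \det (2%:M - E *m E^T) * 2 ^+ k = 2 ^+ n.
Proof.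
move=> EE.
pose A : 'M[R]_(k + n) := block_mx 1%:M E^T E 2%:M.
have dA : \det A = \det (2%:M - E *m E^T).
  have -> : A = block_mx 1%:M 0 E 1%:M *m block_mx 1%:M E^T 0 (2%:M - E *m E^T).
    rewrite mulmx_block !mul1mx !mulmx0 !mul0mx !addr0 mulmx1.
    by rewrite addrC subrK.
  by rewrite det_mulmx det_lblock det_ublock !det1 !mul1r.
have {dA} <- : \det A * 2 ^+ k = \det (2%:M - E *m E^T) * 2 ^+ k by rewrite dA.
have -> : \det A * 2 ^+ k = \det (A *m block_mx 2%:M 0 (- E) 1%:M).
  by rewrite det_mulmx det_lblock det1 mulr1 det_scalar.
have -> : A *m block_mx 2%:M 0 (- E) 1%:M = block_mx 1%:M E^T 0 2%:M.
  rewrite mulmx_block !mul1mx mulmx0 !mulmx1 !mulmxN EE !add0r.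
  congr block_mx.
    by apply/matrixP => i j; rewrite !mxE; case: (i == j) => /=; lra.
  by rewrite scalar_mxC subrr.
by rewrite det_ublock det1 mul1r det_scalar.
Qed.

Variables (n : nat) (f : 'I_n -> V -> R).
Hypothesis lf : forall i, real_linear (f i).
Hypothesis fN : forall i x, `|f i x| <= N x.

(** The values of the functionals [f i] at the vectors [x j]; its determinant
    plays the role of a volume. *)
Definition eval_mx (x : 'I_n -> V) : 'M[R]_n := \matrix_(i, j) f i (x j).

Lemma eval_comp x B : eval_mx (comp_mx x B) = eval_mx x *m B.
Proof.
apply/matrixP => i j; rewrite !mxE /comp_mx /synth real_linear_sum //.
by apply: eq_bigr => l _; rewrite real_linearZ // !mxE mulrC.
Qed.

Lemma contractive_det x : contractive x -> `|\det (eval_mx x)| <= n`!%:R.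
Proof.
move=> cx.
have xle1 j : N (x j) <= 1.
  have := cx (delta_mx j 0).
  rewrite /synth (bigD1 j) //= big1 ?addr0 => [|i ij]; last first.
    by rewrite mxE (negbTE ij) scale0r.
  rewrite mxE !eqxx scale1r /l2norm sqnormE (bigD1 j) //= big1 => [|i ij].
    by rewrite mxE !eqxx expr1n addr0 sqrtr1.
  by rewrite mxE (negbTE ij) expr0n.
rewrite /determinant; apply: le_trans (ler_norm_sum _ _ _) _.
rewrite -card_Sn -sum1_card natr_sum; apply: ler_sum => s _.
rewrite normrM normrX normrN1 expr1n mul1r normr_prod.
apply: prodr_ile1 => i _; rewrite normr_ge0 mxE /=.
exact: le_trans (fN _ _) (xle1 _).
Qed.

(** Some contractive tuple maximizes the determinant up to a factor 2. *)
Lemma near_max_det (z : 'I_n -> V) : \det (eval_mx z) != 0 ->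
  exists x, [/\ contractive x, \det (eval_mx x) != 0 & forall y, contractive y ->
    `|\det (eval_mx y)| < 2 * `|\det (eval_mx x)|].
Proof.
move=> z0.
pose A := [set `|\det (eval_mx x)| | x in @contractive n].
have supA : has_sup A.
  split.
    exists `|\det (eval_mx (fun=> 0))|, (fun=> 0) => // a.
    by rewrite /synth big1 ?seminorm0 ?sqrtr_ge0 // => i _; rewrite scaler0.
  by exists n`!%:R => _ [x cx <-]; exact: contractive_det.
pose c := (1 + \sum_(j < n) N (z j))^-1.
have s0 : 0 < 1 + \sum_(j < n) N (z j).
  by rewrite ltr_pwDl // sumr_ge0 // => j _; exact: seminorm_ge0.
have c0 : 0 < c by rewrite invr_gt0.
have cz : contractive (comp_mx z c%:M).
  move=> a; rewrite synth_comp mul_scalar_mx synthZ (seminormZ sN) gtr0_norm //.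
  rewrite ler_pdivrMl // mulrDl mul1r; apply: ler_wpDl; first exact: sqrtr_ge0.
  apply: le_trans (seminorm_sum sN _ _) _.
  rewrite mulr_suml; apply: ler_sum => j _; rewrite (seminormZ sN) mulrC.
  by apply: ler_wpM2l; [exact: seminorm_ge0|exact: ler_l2norm].
have dz : 0 < `|\det (eval_mx (comp_mx z c%:M))|.
  by rewrite eval_comp det_mulmx det_scalar normr_gt0 mulf_neq0 // expf_neq0
    // gt_eqF.
have A0 : 0 < sup A.
  by apply: lt_le_trans dz _; apply: ub_le_sup;
    [exact: supA.2|exists (comp_mx z c%:M)].
have A2 : 0 < sup A / 2 by rewrite divr_gt0.
have [_ [x cx <-] hx] := sup_adherent A2 supA.
have {}hx : sup A < 2 * `|\det (eval_mx x)| by lra.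
exists x; split => //.
  by rewrite -normr_gt0; lra.
move=> y cy; apply: le_lt_trans hx.
by apply: ub_le_sup; [exact: supA.2|exists y].
Qed.

(** If the operator [synth x] were small on the orthogonal complement of the
    columns of [E], then doubling it there would increase the determinant by
    the factor [2 ^ (n - k)] while the norm grows by at most [5 / 4]. *)
Lemma extend_orthonormal m k x (E : 'M[R]_(n, k)) : n = m.*2 -> (k < m)%N ->
  contractive x -> \det (eval_mx x) != 0 ->
  (forall y, contractive y -> `|\det (eval_mx y)| < 2 * `|\det (eval_mx x)|) ->
  E^T *m E = 1%:M ->
  exists v : 'cV[R]_n, [/\ sqnorm v = 1, E^T *m v = 0 & 4^-1 <= N (synth x v)].
Proof.
move=> nm km cx dx xmax EE; apply: contrapT => noV.
pose P : 'M[R]_n := 1%:M - E *m E^T.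
have EP : E^T *m P = 0 by rewrite mulmxBr mulmx1 mulmxA EE mul1mx subrr.
have PT : P^T = P by rewrite linearB /= trmx1 trmx_mul trmxK.
have PP : P *m P = P.
  by rewrite {1}/P mulmxBl mul1mx -mulmxA EP mulmx0 subr0.
have sqP a : sqnorm (P *m a) <= sqnorm a.
  have -> : sqnorm (P *m a) = sqnorm a - sqnorm (E^T *m a).
    rewrite /sqnorm !trmx_mul PT trmxK -!mulmxA (mulmxA P) PP.
    by rewrite {1}/P mulmxBl mul1mx mulmxBr mulmxA [LHS]mxE [X in _ + X]mxE
      -!mulmxA.
  by rewrite gerBl sqnorm_ge0.
have small a : N (synth x (P *m a)) <= 4^-1 * l2norm (P *m a).
  set v := P *m a; have [v0|v0] := eqVneq (l2norm v) 0.
    by have := cx v; rewrite v0 mulr0.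
  have lv : 0 < l2norm v by rewrite lt_def v0 sqrtr_ge0.
  (* otherwise [v], normalized, would be the vector sought *)
  rewrite leNgt; apply/negP => hv; apply: noV; exists ((l2norm v)^-1 *: v); split.
  - rewrite -[sqnorm _]sqr_sqrtr ?sqnorm_ge0 // -/(l2norm _) l2normZ.
    by rewrite ger0_norm ?invr_ge0 ?mulVf ?expr1n ?ltW.
  - by rewrite -scalemxAr mulmxA EP mul0mx scaler0.
  - rewrite synthZ (seminormZ sN) ger0_norm ?invr_ge0; last exact: ltW.
    by rewrite ler_pdivlMl // mulrC ltW.
pose B : 'M[R]_n := (4 / 5) *: (2%:M - E *m E^T).
have BE a : B *m a = (4 / 5) *: (a + P *m a).
  rewrite -scalemxAl; congr (_ *: _).
  rewrite mulmxBl [P *m a]mulmxBl mul1mx addrA -mulr2n mul_scalar_mx.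
  by rewrite scaler_nat.
have cB : contractive (comp_mx x B).
  move=> a; rewrite synth_comp BE synthZ (seminormZ sN) synthD.
  have h1 := seminorm_ler sN (synth x a) (synth x (P *m a)).
  have h2 := cx a; have h3 := small a.
  have h4 : l2norm (P *m a) <= l2norm a by apply: ler_wsqrtr.
  rewrite ger0_norm; last by lra.
  lra.
have := xmax _ cB; rewrite eval_comp det_mulmx normrM mulrC.
rewrite ltr_pM2r ?normr_gt0 // ltNge => /negP; apply.
have kn : (k <= n)%N by rewrite nm -addnn;
  apply: leq_trans (ltnW km) (leq_addr _ _).
have dE : \det (2%:M - E *m E^T) = 2 ^+ (n - k).
  have k0 : 2 ^+ k != 0 :> R by rewrite expf_neq0 // pnatr_eq0.
  by apply: (mulIf k0); rewrite det_compl_orthonormal // -exprD subnK.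
rewrite detZ dE ger0_norm; last by rewrite mulr_ge0 // exprn_ge0 //; lra.
have -> : (n - k = m + (m - k.+1).+1)%N by rewrite nm; lia.
have : 1 <= (4 / 5 : R) ^+ 2 * 2 by rewrite expr2; lra.
move: (4 / 5 : R) => q q1; rewrite exprD mulrA nm -mul2n exprM -(exprMn m).
by rewrite [2 ^+ _.+1]exprS mulrCA ler_peMr // mulr_ege1 // exprn_ege1 // ler1n.
Qed.

(** Orthonormal columns on which [synth x] is not small, chosen one by one. *)
Lemma orthonormal_large m k x : n = m.*2 -> (k <= m)%N ->
  contractive x -> \det (eval_mx x) != 0 ->
  (forall y, contractive y -> `|\det (eval_mx y)| < 2 * `|\det (eval_mx x)|) ->
  exists2 E : 'M[R]_(n, k), E^T *m E = 1%:M &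
    forall i, 4^-1 <= N (synth x (col i E)).
Proof.
move=> nm + cx dx xmax; elim: k => [_|k IHk km].
  by exists 0 => [|[]//]; apply/matrixP => -[].
have [E EE hE] := IHk (ltnW km).
have [v [v1 Ev hv]] := extend_orthonormal nm km cx dx xmax EE.
have vE : v^T *m E = 0 by apply: trmx_inj; rewrite trmx_mul trmxK Ev trmx0.
have vv : v^T *m v = 1%:M.
  by apply/matrixP => i j; rewrite !ord1 -/(sqnorm v) v1 mxE.
have vEE : (row_mx v E)^T *m row_mx v E = 1%:M.
  by rewrite tr_row_mx mul_col_row EE Ev vE vv -scalar_mx_block.
exists (row_mx v E) => //.
suff large (i : 'I_(1 + k)) : 4^-1 <= N (synth x (col i (row_mx v E))) by [].
case: (split_ordP i) => j ->; last by rewrite colKr.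
by rewrite colKl; have -> : col j v = v by apply/matrixP => a b; rewrite !ord1 !mxE.
Qed.

End DvoretzkyRogers.

(** Arbitrarily long sequences of vectors that are bounded below, while their
    weak square-summing norm is at most one. *)
Theorem dvoretzky_rogers (R : realType) (V : lmodType R) (N : V -> R) (m : nat) :
  infinite_dimensional V -> seminorm N -> (forall x, N x = 0 -> x = 0) ->
  exists x : 'I_m -> V, (forall i, 4^-1 <= N (x i)) /\
    forall a : 'I_m -> R, N (\sum_(i < m) a i *: x i) <=
                          Num.sqrt (\sum_(i < m) a i ^+ 2).
Proof.
move=> V_inf sN N0.
have [z [g zg]] := triangular_system V_inf sN N0 m.*2.
pose f (i : 'I_m.*2) := g i.
have lf i : real_linear (f i) by have [h _ _ _] := zg i (ltn_ord i).
have fN i y : `|f i y| <= N y by have [_ h _ _] := zg i (ltn_ord i); exact: h.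
have dz : \det (eval_mx f (fun j => z j)) != 0.
  rewrite det_trig; last first.
    apply/is_trig_mxP => i j ij; rewrite mxE.
    by have [_ _ _] := zg j (ltn_ord j); apply.
  by apply/prodf_neq0 => i _; rewrite mxE; have [_ _ h _] := zg i (ltn_ord i).
have [x [cx dx xmax]] := near_max_det sN lf fN dz.
have [E EE hE] := orthonormal_large sN lf erefl (leqnn m) cx dx xmax.
exists (comp_mx x E); split => // a.
have := cx (E *m \col_i a i); rewrite -synth_comp /l2norm.
have -> : sqnorm (E *m \col_i a i) = sqnorm (\col_i a i).
  by rewrite /sqnorm trmx_mul -mulmxA (mulmxA E^T) EE mul1mx.
rewrite sqnormE (eq_bigr (fun i => a i ^+ 2)) => [|i _]; last by rewrite mxE.
by rewrite /synth (eq_bigr (fun i => a i *: comp_mx x E i)) => // i _; rewrite mxE.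
Qed.

(** * Rademacher averages and spaces without cotype *)

Section RademacherAverage.
Variables (R : realType) (V : lmodType R).
Implicit Types (ys s : seq V) (h : V -> R).

(** The average of [h] over all signed sums of the vectors of [ys]. *)
Fixpoint ravg ys h : R :=
  if ys is y :: ys' then
    (ravg ys' (fun v => h (y + v)) + ravg ys' (fun v => h (- y + v))) / 2
  else h 0.

Lemma eq_ravg ys h1 h2 : h1 =1 h2 -> ravg ys h1 = ravg ys h2.
Proof. by move=> /funext ->. Qed.

Lemma le_ravg ys h1 h2 : (forall v, h1 v <= h2 v) -> ravg ys h1 <= ravg ys h2.
Proof.
elim: ys h1 h2 => [|y ys IHys] h1 h2 h12 /=; first exact: h12.
by rewrite ler_pM2r ?invr_gt0 // lerD // IHys.
Qed.

Lemma ravgD ys h1 h2 :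
  ravg ys (fun v => h1 v + h2 v) = ravg ys h1 + ravg ys h2.
Proof.
elim: ys h1 h2 => [|y ys IHys] h1 h2 //=.
by rewrite !IHys -mulrDl; congr (_ / _); rewrite addrACA.
Qed.

Lemma ravgZ ys c h : ravg ys (fun v => c * h v) = c * ravg ys h.
Proof.
elim: ys h => [|y ys IHys] h //=.
by rewrite !IHys -mulrDr mulrA.
Qed.

Lemma ravg_cst ys c : ravg ys (fun=> c) = c.
Proof. by elim: ys => //= y ys ->; lra. Qed.

Lemma ravgN ys h : ravg ys (fun v => h (- v)) = ravg ys h.
Proof.
elim: ys h => [|y ys IHys] h /=; first by rewrite oppr0.
rewrite addrC; congr ((_ + _) / _); rewrite -[RHS]IHys; apply: eq_ravg => v.
  by rewrite opprD opprK.
by rewrite opprD.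
Qed.

Lemma ravg_cat ys1 ys2 h :
  ravg (ys1 ++ ys2) h = ravg ys1 (fun v => ravg ys2 (fun w => h (v + w))).
Proof.
elim: ys1 h => [|y ys IHys] h /=; first by apply: eq_ravg => v; rewrite add0r.
by rewrite !IHys; congr ((_ + _) / _); apply: eq_ravg => v; apply: eq_ravg => w;
  rewrite addrA.
Qed.

(** The average of [H] over all choices of one signed sum of each list. *)
Fixpoint ravgs (yss : seq (seq V)) (H : seq V -> R) : R :=
  if yss is ys :: yss' then ravg ys (fun v => ravgs yss' (fun vs => H (v :: vs)))
  else H [::].

Lemma le_ravgs yss (H1 H2 : seq V -> R) :
  (forall vs, size vs = size yss -> H1 vs <= H2 vs) ->
  ravgs yss H1 <= ravgs yss H2.
Proof.
elim: yss H1 H2 => [|ys yss IHyss] H1 H2 h12 /=; first exact: h12.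
by apply: le_ravg => v; apply: IHyss => vs vsE; apply: h12; rewrite /= vsE.
Qed.

Lemma ravgsD yss H1 H2 :
  ravgs yss (fun vs => H1 vs + H2 vs) = ravgs yss H1 + ravgs yss H2.
Proof.
elim: yss H1 H2 => [|ys yss IHyss] H1 H2 //=.
by rewrite -ravgD; apply: eq_ravg => v; exact: IHyss.
Qed.

Lemma ravgsZ yss c H : ravgs yss (fun vs => c * H vs) = c * ravgs yss H.
Proof.
elim: yss H => [|ys yss IHyss] H //=.
by rewrite -ravgZ; apply: eq_ravg => v; exact: IHyss.
Qed.

Lemma ravgs_cst yss c : ravgs yss (fun=> c) = c.
Proof.
elim: yss => //= ys yss IHyss.
by rewrite -[RHS](ravg_cst ys); exact: eq_ravg.
Qed.

Lemma ravgs_sum yss (h : V -> R) :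
  ravgs yss (fun vs => \sum_(v <- vs) h v) = \sum_(ys <- yss) ravg ys h.
Proof.
elim: yss => [|ys yss IHyss] /=; first by rewrite !big_nil.
rewrite big_cons -IHyss -[X in _ + X](ravg_cst ys) -ravgD.
apply: eq_ravg => v.
rewrite -[X in X + _](ravgs_cst yss) -ravgsD.
by congr ravgs; apply/funext => vs; rewrite big_cons.
Qed.

(** Multiplying each block by an additional random sign does not change
    anything, because signed sums are symmetric. *)
Lemma ravg_flatten yss h : ravg (flatten yss) h = ravgs yss (fun vs => ravg vs h).
Proof.
elim: yss h => [|ys yss IHyss] h //=.
rewrite ravg_cat.
pose g v := ravgs yss (fun vs => ravg vs (fun w => h (v + w))).
have -> : ravg ys (fun v => ravg (flatten yss) (fun w => h (v + w))) = ravg ys g.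
  by apply: eq_ravg => v; rewrite IHyss.
have -> : ravg ys g = 2^-1 * (ravg ys g + ravg ys (fun v => g (- v))).
  by rewrite ravgN; lra.
rewrite -ravgD -ravgZ; apply: eq_ravg => v.
rewrite -ravgsD -ravgsZ; congr ravgs; apply/funext => vs.
by rewrite mulrC.
Qed.

(** [v] is a signed sum of the vectors of [ys]. *)
Fixpoint signed_sum ys (v : V) : Prop :=
  if ys is y :: ys' then
    exists2 w, signed_sum ys' w & v = y + w \/ v = - y + w
  else v = 0.

Lemma signed_sum_ravg ys h v : (forall w, 0 <= h w) -> signed_sum ys v ->
  h v <= 2 ^+ size ys * ravg ys h.
Proof.
elim: ys h v => [|y ys IHys] h v h0 /=; first by move=> ->; rewrite mul1r.
have pos h' : (forall w, 0 <= h' w) -> 0 <= 2 ^+ size ys * ravg ys h'.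
  move=> h'0; rewrite mulr_ge0 ?exprn_ge0 //.
  by rewrite -(ravg_cst ys 0); exact: le_ravg.
have p1 := pos (fun w => h (y + w)) (fun w => h0 _).
have p2 := pos (fun w => h (- y + w)) (fun w => h0 _).
move=> [w sw]; rewrite exprS => -[->|->].
  by have := IHys (fun w => h (y + w)) w (fun w => h0 _) sw; lra.
by have := IHys (fun w => h (- y + w)) w (fun w => h0 _) sw; lra.
Qed.

Lemma signed_sumZ ys c v : signed_sum [seq c *: y | y <- ys] v ->
  exists2 w, signed_sum ys w & v = c *: w.
Proof.
elim: ys v => [|y ys IHys] v /=; first by move=> ->; exists 0; rewrite ?scaler0.
move=> [w /IHys[w' sw ->] [->|->]].
  by exists (y + w'); [exists w'; [|left]|rewrite scalerDr].
by exists (- y + w'); [exists w'; [|right]|rewrite scalerDr scalerN].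
Qed.

End RademacherAverage.

Section Cotype.
Variables (R : realType) (V : lmodType R) (N : V -> R).
Hypothesis sN : seminorm N.
Implicit Types ys s : seq V.

Lemma seminorm_sqr_pair x y : N x ^+ 2 <= (N (y + x) ^+ 2 + N (y - x) ^+ 2) / 2.
Proof.
have := seminorm_pair sN x y.
have := seminorm_ge0 sN x; have := seminorm_ge0 sN (y + x).
have := seminorm_ge0 sN (y - x).
move: (N x) (N (y + x)) (N (y - x)) => a b c c0 b0 a0 abc.
have := sqr_ge0 (b - c); nra.
Qed.

(** The square of the Rademacher norm of a finite sequence. *)
Definition rademacher_sq ys : R := ravg ys (fun v => N v ^+ 2).

Lemma le_rademacher_sq_subseq s ys : subseq s ys ->
  rademacher_sq s <= rademacher_sq ys.
Proof.
have E t : rademacher_sq t = ravg t (fun v => N (0 + v) ^+ 2).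
  by apply: eq_ravg => v; rewrite add0r.
rewrite !E; elim: ys s 0 => [|y ys IHys] s z; first by move=> /eqP ->.
case: s => [_|x s].
  rewrite [leLHS]/=; have := IHys [::] (z + y) (sub0seq _).
  have := IHys [::] (z - y) (sub0seq _) => /=.
  have := seminorm_sqr_pair z y; rewrite !addr0 -[N (y - z)](seminormN sN) opprB.
  rewrite [y + z]addrC => h1 h2 h3.
  under [X in _ <= (X + _) / _]eq_ravg do rewrite addrA.
  under [X in _ <= (_ + X) / _]eq_ravg do rewrite addrA.
  by move: h1 h2 h3; lra.
move=> /=; case: eqP => [->|_] sub.
  have h1 := IHys s (z + y) sub; have h2 := IHys s (z - y) sub.
  under [X in (X + _) / _ <= _]eq_ravg do rewrite addrA.
  under [X in (_ + X) / _ <= _]eq_ravg do rewrite addrA.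
  under [X in _ <= (X + _) / _]eq_ravg do rewrite addrA.
  under [X in _ <= (_ + X) / _]eq_ravg do rewrite addrA.
  by move: h1 h2; lra.
have := IHys (x :: s) z sub => h; apply: le_trans h _.
rewrite -ravgD mulrC -ravgZ; apply: le_ravg => v.
have := seminorm_sqr_pair (z + v) y.
by rewrite -[N (y - _)](seminormN sN) opprB (addrCA y) addrAC -(addrA z) mulrC
  [- y + v]addrC addrA.
Qed.
(** Monotonicity for the one-element subsequence [[:: y]]. *)
Lemma seminorm_le_rademacher_sq y ys : y \in ys -> N y ^+ 2 <= rademacher_sq ys.
Proof.
move=> yys; have := @le_rademacher_sq_subseq [:: y] ys.
rewrite sub1seq yys /rademacher_sq /= !addr0 (seminormN sN) => /(_ isT).
by apply: le_trans; lra.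
Qed.

Lemma rademacher_sq_ge0 ys : 0 <= rademacher_sq ys.
Proof.
have := le_rademacher_sq_subseq (sub0seq ys); apply: le_trans.
by rewrite /rademacher_sq /= sqr_ge0.
Qed.

Section Power.
Variables (n : nat) (d : R).
Hypotheses (n0 : (0 < n)%N) (d0 : 0 < d).
(** For [d = 1] this always holds; [d < 1] is a gain for [n] vectors. *)
Hypothesis gain : forall ys, size ys = n ->
  \sum_(y <- ys) N y ^+ 2 <= n%:R * d * rademacher_sq ys.

(** The sequence is cut into [n] blocks of length [n ^ k]. The induction
    hypothesis applies to each block, and the gain to the [n] signed sums of the
    blocks. *)
Lemma gain_power k ys : size ys = (n ^ k)%N ->
  \sum_(y <- ys) N y ^+ 2 <= (n%:R * d) ^+ k * rademacher_sq ys.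
Proof.
have nd0 : 0 <= n%:R * d by rewrite mulr_ge0 // ltW.
elim: k ys => [|k IHk] ys.
  case: ys => [//|y [|//]] _; rewrite big_seq1 mul1r.
  by apply: seminorm_le_rademacher_sq; rewrite mem_head.
move=> sys; pose yss := reshape (nseq n (n ^ k)%N) ys.
have yssE : flatten yss = ys by apply: reshapeKr; rewrite sumn_nseq sys expnS mulnC.
have size_yss : size yss = n by rewrite size_reshape size_nseq.
have size_blocks ys' : ys' \in yss -> size ys' = (n ^ k)%N.
  move=> /(map_f size); rewrite -/(shape yss) reshapeKl.
    by rewrite mem_nseq => /andP[_ /eqP].
  by rewrite sumn_nseq sys expnS mulnC.
rewrite -{1}yssE big_flatten /=.
have h1 : \sum_(ys' <- yss) \sum_(y <- ys') N y ^+ 2 <=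
    (n%:R * d) ^+ k * \sum_(ys' <- yss) rademacher_sq ys'.
  rewrite mulr_sumr big_seq [leRHS]big_seq; apply: ler_sum => ys' /size_blocks.
  exact: IHk.
apply: le_trans h1 _; rewrite exprSr -mulrA ler_wpM2l ?exprn_ge0 //.
rewrite -ravgs_sum /rademacher_sq -{1}yssE ravg_flatten -ravgsZ.
by apply: le_ravgs => vs vsE; apply: gain; rewrite vsE.
Qed.

(** Applied to [n ^ k] large vectors, [gain_power] would be violated. *)
Lemma count_large k ys :
  (count (fun y => d ^+ k * rademacher_sq ys < N y ^+ 2)%R ys < n ^ k)%N.
Proof.
set a := (fun y => _); rewrite ltnNge -size_filter; apply/negP => big.
pose s := take (n ^ k) [seq y <- ys | a y].
have ss : size s = (n ^ k)%N by rewrite size_take_min; exact/minn_idPl.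
have subs : subseq s ys.
  exact: subseq_trans (take_subseq _ _) (filter_subseq _ _).
have := gain_power ss; rewrite leNgt => /negP; apply.
have h1 : (n%:R * d) ^+ k * rademacher_sq s <= (n%:R * d) ^+ k * rademacher_sq ys.
  by rewrite ler_wpM2l ?le_rademacher_sq_subseq // exprn_ge0 // mulr_ge0 // ltW.
apply: le_lt_trans h1 _.
have -> : (n%:R * d) ^+ k * rademacher_sq ys
    = \sum_(y <- s) (d ^+ k * rademacher_sq ys).
  by rewrite big_const_seq count_predT ss iter_addr_0 exprMn -natrX -mulrA
    mulr_natl.
rewrite big_seq [ltRHS]big_seq; apply: ltr_sum.
  have : (0 < size s)%N by rewrite ss expn_gt0 n0.
  by case: (s) => // y s' _; apply/hasP; exists y; rewrite ?mem_head.
by move=> y /mem_take; rewrite mem_filter => /andP[].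
Qed.

(** The sum is split into the layers [d^(k+1) A < N y ^ 2 <= d^k A], where [A] is
    the Rademacher average. By [count_large] the layer [k] has less than
    [n^(k+1)] terms, so it contributes at most [n (n d^r)^k A^r]. The terms below
    the last layer considered are negligible. *)
Lemma gain_cotype r : n%:R * d ^+ r <= 2^-1 -> (0 < r)%N -> d < 1 ->
  forall ys, \sum_(y <- ys) N y ^+ 2 ^+ r <=
    (2 * n%:R + 1) * rademacher_sq ys ^+ r.
Proof.
move=> ndr r0 d1 ys; set A := rademacher_sq ys.
have A0 : 0 <= A := rademacher_sq_ge0 ys.
have dk k : 0 < d ^+ k by rewrite exprn_gt0.
have layer K : \sum_(y <- ys | d ^+ K * A < N y ^+ 2) N y ^+ 2 ^+ r <=
    \sum_(k < K) n%:R ^+ k.+1 * (d ^+ k * A) ^+ r.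
  elim: K => [|K IHK].
    rewrite big_ord0 mul1r big_seq_cond big1 // => y /andP[yys].
    by rewrite ltNge seminorm_le_rademacher_sq.
  rewrite big_ord_recr /= (bigID (fun y => d ^+ K * A < N y ^+ 2)) /=.
  apply: lerD.
    apply: le_trans IHK; rewrite [leLHS]big_mkcond [leRHS]big_mkcond.
    apply: ler_sum => y _; case: ifP => [/andP[_ ->] //|_].
    by case: ifP => // _; rewrite exprn_ge0 // sqr_ge0.
  apply: (@le_trans _ _ (\sum_(y <- ys | d ^+ K.+1 * A < N y ^+ 2)
                            (d ^+ K * A) ^+ r)).
    rewrite [leLHS]big_mkcondr; apply: ler_sum => y _.
    case: ifP => [|_]; last by rewrite exprn_ge0 // mulr_ge0 // ltW.
    by rewrite -leNgt => h; apply: lerXn2r;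
      rewrite ?nnegrE ?sqr_ge0 ?mulr_ge0 // ltW.
  rewrite big_const_seq iter_addr_0 -[leLHS]mulr_natl ler_wpM2r //.
    by rewrite exprn_ge0 // mulr_ge0 // ltW.
  by rewrite -natrX ler_nat ltnW // count_large.
(* enough layers for the remaining terms to sum up to at most [A ^ r] *)
pose K := size ys.
rewrite (bigID (fun y => d ^+ K * A < N y ^+ 2)) /= mulrDl mul1r lerD //.
  apply: le_trans (layer K) _.
  have -> : \sum_(k < K) n%:R ^+ k.+1 * (d ^+ k * A) ^+ r
      = n%:R * A ^+ r * \sum_(k < K) (n%:R * d ^+ r) ^+ k.
    rewrite mulr_sumr; apply: eq_bigr => k _.
    by rewrite exprS !exprMn -!exprM [(r * k)%N]mulnC; ring.
  rewrite -mulrA [2 * _]mulrC -!mulrA ler_wpM2l // mulrC ler_wpM2r ?exprn_ge0 //.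
  have : \sum_(k < K) (n%:R * d ^+ r) ^+ k <= 2 - 2^-1 ^+ K *+ 2.
    elim: {layer}K => [|K IHK]; first by rewrite big_ord0 subrr.
    rewrite big_ord_recr /=.
    have : (n%:R * d ^+ r) ^+ K <= 2^-1 ^+ K.
      by apply: lerXn2r; rewrite ?nnegrE ?mulr_ge0 ?invr_ge0 // ltW.
    by move: IHK; rewrite [2^-1 ^+ K.+1]exprS; lra.
  move=> h; apply: le_trans h _.
  by rewrite gerBl mulrn_wge0 // exprn_ge0 // invr_ge0.
apply: (@le_trans _ _ (\sum_(y <- ys) (2^-1 ^+ K * A ^+ r))).
  rewrite big_mkcond; apply: ler_sum => y _; case: ifP => [|_]; last first.
    by rewrite mulr_ge0 // exprn_ge0 // invr_ge0.
  rewrite -leNgt => h.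
  have h1 : N y ^+ 2 ^+ r <= (d ^+ K * A) ^+ r.
    by apply: lerXn2r; rewrite ?nnegrE ?sqr_ge0 ?mulr_ge0 // ltW.
  apply: le_trans h1 _; rewrite exprMn ler_wpM2r ?exprn_ge0 //.
  rewrite -exprM mulnC exprM; apply: lerXn2r; rewrite ?nnegrE ?invr_ge0 //.
    exact: ltW.
  apply: le_trans ndr; rewrite ler_peMl ?ler1n //; exact: ltW.
rewrite big_const_seq count_predT iter_addr_0 -[leLHS]mulr_natl mulrA ler_piMl
  ?exprn_ge0 //.
rewrite exprVn ler_pdivrMr ?exprn_gt0 // mul1r -natrX ler_nat.
by rewrite ltnW // ltn_expl.
Qed.

End Power.

(** Bernoulli's inequality for [1 / d]. *)
Lemma geometric_small (d e : R) : 0 < d < 1 -> 0 < e -> exists r : nat, d ^+ r <= e.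
Proof.
move=> /andP[d0 d1] e0.
pose h := d^-1 - 1.
have h0 : 0 < h by rewrite subr_gt0 invf_gt1.
have bernoulli r : 1 + r%:R * h <= d^-1 ^+ r.
  elim: r => [|r IHr]; first by rewrite mul0r addr0.
  rewrite exprS -natr1 mulrDl mul1r; have -> : d^-1 = 1 + h by rewrite /h; lra.
  have -> : (1 + h) ^+ r = d^-1 ^+ r by congr (_ ^+ _); rewrite /h; lra.
  have : 0 <= r%:R * h by rewrite mulr_ge0 // ltW.
  move: h0 IHr; move: (d^-1 ^+ r) (r%:R * h) => x y h0 IHr y0.
  have : h * (1 + y) <= h * x by rewrite ler_pM2l.
  have : 0 <= h * y by rewrite mulr_ge0 // ltW.
  by rewrite mulrDr mulr1; lra.
have /archi_boundP : 0 <= e^-1 / h by rewrite divr_ge0 ?invr_ge0 // ltW.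
set r := Num.bound _ => hr; exists r.
rewrite -lef_pV2 ?posrE ?exprn_gt0 // -exprVn.
apply: le_trans (bernoulli r).
by move: hr; rewrite ltr_pdivrMr //; lra.
Qed.

(** Either a gain for some number of vectors propagates to a cotype
    inequality, or there is no gain for any number of vectors. *)
Lemma cotype_dichotomy :
  (forall r (C : R), (0 < r)%N -> 0 <= C ->
     ~ forall ys, \sum_(y <- ys) N y ^+ 2 ^+ r <= C * rademacher_sq ys ^+ r) ->
  forall n d, (0 < n)%N -> 0 < d < 1 -> exists2 ys, size ys = n &
    n%:R * d * rademacher_sq ys < \sum_(y <- ys) N y ^+ 2.
Proof.
move=> noC n d n0 d01; apply: contrapT => h.
have gain ys : size ys = n ->
    \sum_(y <- ys) N y ^+ 2 <= n%:R * d * rademacher_sq ys.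
  by move=> sys; rewrite leNgt; apply/negP => hys; apply: h; exists ys.
have /andP[d0 d1] := d01.
have nR : 0 < n%:R :> R by rewrite ltr0n.
have [|r hr] := @geometric_small d (2^-1 / n%:R) d01.
  by rewrite divr_gt0 // invr_gt0.
have ndr : n%:R * d ^+ r.+1 <= 2^-1.
  rewrite mulrC -ler_pdivlMr //; apply: le_trans hr.
  by rewrite exprS ler_piMl ?exprn_ge0 // ltW.
have C0 : 0 <= 2 * n%:R + 1 :> R by rewrite addr_ge0 // mulr_ge0.
by apply: (noC r.+1 _ (ltn0Sn r) C0) => ys; exact: (gain_cotype n0 d0 gain ndr).
Qed.

(** By convexity, signs are the extreme case of coefficients in [-1, 1]. *)
Lemma signed_sum_le_combination ys (a : nat -> R) z c :
  (forall i, `|a i| <= 1) -> (forall v, signed_sum ys v -> N (z + v) <= c) ->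
  N (z + \sum_(i < size ys) a i *: nth 0 ys i) <= c.
Proof.
elim: ys a z => [|y ys IHys] a z a1 hc /=; first by rewrite big_ord0; exact: hc.
rewrite big_ord_recl /=.
set w := \sum_(i < _) _.
have wE : w = \sum_(i < size ys) a i.+1 *: nth 0 ys i by [].
have h1 : N (z + y + w) <= c.
  rewrite wE; apply: (IHys (fun i => a i.+1)) => // v sv.
  by rewrite -addrA; apply: hc; exists v => //; left.
have h2 : N (z - y + w) <= c.
  rewrite wE; apply: (IHys (fun i => a i.+1)) => // v sv.
  by rewrite -addrA; apply: hc; exists v => //; right.
(* the scalar [a 0] of [-1, 1] is a convex combination of the two signs *)
have /andP[lo hi] : - 1 <= a 0 <= 1 by rewrite -ler_norml.
have -> : z + (a 0 *: y + w)
    = ((1 + a 0) / 2) *: (z + y + w) + ((1 - a 0) / 2) *: (z - y + w).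
  have p1 : (1 + a 0) / 2 + (1 - a 0) / 2 = 1 by lra.
  have p2 : (1 + a 0) / 2 - (1 - a 0) / 2 = a 0 by lra.
  rewrite -{1}p2; move: ((1 + a 0) / 2) ((1 - a 0) / 2) p1 => s t st.
  rewrite !scalerDr scalerN [RHS]addrACA [X in _ = X + _]addrACA.
  by rewrite -scalerBl -!scalerDl st !scale1r addrA.
apply: le_trans (seminorm_ler sN _ _) _; rewrite !(seminormZ sN).
have -> : `|(1 + a 0) / 2| = (1 + a 0) / 2 by apply: ger0_norm; lra.
have -> : `|(1 - a 0) / 2| = (1 - a 0) / 2 by apply: ger0_norm; lra.
have m1 : (1 + a 0) / 2 * N (z + y + w) <= (1 + a 0) / 2 * c.
  by apply: ler_wpM2l => //; lra.
have m2 : (1 - a 0) / 2 * N (z - y + w) <= (1 - a 0) / 2 * c.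
  by apply: ler_wpM2l => //; lra.
lra.
Qed.

(** When the gain is negligible, each pair of opposite signs of one vector
    contributes almost the same to the average, so that no signed sum is much
    larger than the average. *)
Lemma signed_sum_bounded n ys : size ys = n.+1 ->
  n.+1%:R * (1 - (n.+1%:R * 2 ^+ n.+1)^-1) * rademacher_sq ys <
    \sum_(y <- ys) N y ^+ 2 ->
  [/\ 0 < rademacher_sq ys,
      forall y, y \in ys -> rademacher_sq ys / 4 <= N y ^+ 2 &
      forall v, signed_sum ys v -> N v ^+ 2 <= 4 * rademacher_sq ys].
Proof.
move=> sys; set A := rademacher_sq ys; set q := 2 ^+ n.+1 => big.
have q2 : 2 <= q by rewrite /q exprS ler_peMr // exprn_ege1 // ler1n.
have q0 : 0 < q by lra.
have A0 : 0 <= A := rademacher_sq_ge0 ys.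
have yle y : y \in ys -> N y ^+ 2 <= A by apply: seminorm_le_rademacher_sq.
have {}big : (n.+1%:R - q^-1) * A < \sum_(y <- ys) N y ^+ 2.
  by move: big; rewrite mulrBr mulr1 invfM mulrA divff ?pnatr_eq0 // mul1r.
have ylow y : y \in ys -> (1 - q^-1) * A < N y ^+ 2.
  move=> yys; move: big; rewrite (perm_big _ (perm_to_rem yys)) big_cons /=.
  have : \sum_(x <- rem y ys) N x ^+ 2 <= n%:R * A.
    have -> : n%:R * A = \sum_(x <- rem y ys) A.
      by rewrite big_const_seq count_predT size_rem // sys iter_addr_0 mulr_natl.
    by rewrite big_seq [leRHS]big_seq; apply: ler_sum => x /mem_rem; exact: yle.
  by rewrite -natr1; lra.
have qi : 0 < q^-1 <= 2^-1 by rewrite invr_gt0 q0 lef_pV2 ?posrE.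
have /andP[qi0 qi2] := qi.
have qA : q^-1 * A <= A / 2 by rewrite [A / 2]mulrC ler_wpM2r.
have [y [ys' ysE]] : exists y ys', ys = y :: ys'.
  by case: (ys) sys => [//|y ys'] _; exists y, ys'.
have yys : y \in ys by rewrite ysE mem_head.
have Agt0 : 0 < A.
  by have := ylow y yys; have := yle y yys; lra.
split => // [x xys|v].
  by have := ylow x xys; lra.
have sys' : size ys' = n by move: sys; rewrite ysE => -[].
pose g v := 2^-1 * (N (y + v) ^+ 2 + N (- y + v) ^+ 2) + - N y ^+ 2.
have NE w : N (- y + w) = N (w - y) by rewrite addrC.
have NE' w : N (y + w) = N (w + y) by rewrite addrC.
have g0 w : 0 <= g w.
  by rewrite /g NE NE'; have := seminorm_sqr_pair y w; lra.
have gA : ravg ys' g = A - N y ^+ 2.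
  by rewrite /g ravgD ravgZ ravgD ravg_cst /A ysE /rademacher_sq /=; lra.
have gle w : signed_sum ys' w -> g w <= A / 2.
  move=> sw; apply: le_trans (signed_sum_ravg g0 sw) _.
  rewrite gA sys'; have := ylow y yys => h.
  have h1 : A - N y ^+ 2 <= q^-1 * A by lra.
  have := ler_wpM2l (_ : 0 <= 2 ^+ n) h1 => h2.
  apply: le_trans (h2 _) _; first by rewrite exprn_ge0.
  have p0 : 2 ^+ n != 0 :> R by rewrite expf_neq0 // pnatr_eq0.
  rewrite /q exprS; have -> : (2 * 2 ^+ n)^-1 = (2 ^+ n)^-1 / 2 :> R.
    by rewrite invfM mulrC.
  by rewrite !mulrA divff // mul1r mulrC.
have yA := yle y yys.
have s1 w : 0 <= N (y + w) ^+ 2 by rewrite sqr_ge0.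
have s2 w : 0 <= N (- y + w) ^+ 2 by rewrite sqr_ge0.
rewrite ysE => -[w sw] [->|->].
  by have := gle w sw; rewrite /g; have := s2 w; lra.
by have := gle w sw; rewrite /g; have := s1 w; lra.
Qed.

(** A space without cotype contains the finite-dimensional spaces of bounded
    sequences, in the sense that it has arbitrarily long sequences of vectors
    bounded below whose combinations with coefficients in [-1, 1] are bounded
    by an absolute constant. *)
Theorem no_cotype_bounded_combinations (m : nat) :
  (forall r (C : R), (0 < r)%N -> 0 <= C ->
     ~ forall ys, \sum_(y <- ys) N y ^+ 2 ^+ r <= C * rademacher_sq ys ^+ r) ->
  exists y : 'I_m -> V, (forall i, 2^-1 <= N (y i)) /\
    forall a : 'I_m -> R, (forall i, `|a i| <= 1) ->
      N (\sum_(i < m) a i *: y i) <= 2.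
Proof.
case: m => [|n] noC.
  exists (fun=> 0); split => [[]//|a _].
  by rewrite big_ord0 (seminorm0 sN).
(* a gain so close to one that it is negligible for each sign pattern *)
pose d : R := 1 - (n.+1%:R * 2 ^+ n.+1)^-1.
have d01 : 0 < d < 1.
  have h : 1 < n.+1%:R * 2 ^+ n.+1 :> R.
    have : (1 < n.+1 * 2 ^ n.+1)%N by rewrite expnS; have := expn_gt0 2 n; lia.
    by rewrite -(ltr_nat R) natrM natrX.
  rewrite subr_gt0 invf_lt1 ?h /= ?gtrBl ?invr_gt0; lra.
have [ys sys big] := cotype_dichotomy noC (ltn0Sn n) d01.
have [A0 low up] := signed_sum_bounded sys big.
set A := rademacher_sq ys in A0 low up.
(* normalization: the vectors are divided by their Rademacher norm *)
pose c := (Num.sqrt A)^-1.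
have s0 : 0 < Num.sqrt A by rewrite sqrtr_gt0.
have c0 : 0 < c by rewrite invr_gt0.
have sA : Num.sqrt A ^+ 2 = A by rewrite sqr_sqrtr // ltW.
pose zs := [seq c *: y | y <- ys].
have szs : size zs = n.+1 by rewrite size_map.
exists (fun i => nth 0 zs i); split => [i|a a1].
  have isz : (i < size ys)%N by rewrite sys.
  rewrite (nth_map 0) // (seminormZ sN) gtr0_norm //.
  rewrite /c ler_pdivlMl //.
  have e0 : 0 <= Num.sqrt A * 2^-1 by rewrite divr_ge0 // ltW.
  rewrite -(@ler_pXn2r _ 2) ?nnegrE ?e0 ?(seminorm_ge0 sN) //.
  by apply: le_trans (low _ (mem_nth 0 isz)); rewrite exprMn sA expr2; lra.
(* the coefficients [a], extended by zero to all natural numbers *)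
pose b i := if (i < n.+1)%N =P true is ReflectT h then a (Ordinal h) else 0.
have bE (i : 'I_n.+1) : b i = a i.
  rewrite /b; case: eqP => [h|]; last by rewrite ltn_ord.
  by congr a; exact: val_inj.
have := @signed_sum_le_combination zs b 0 2; rewrite szs add0r.
under eq_bigr do rewrite bE; apply.
  by move=> i; rewrite /b; case: eqP => [h|_] //; rewrite normr0.
move=> v /signed_sumZ[w sw ->]; rewrite add0r (seminormZ sN) gtr0_norm //.
rewrite /c ler_pdivrMl //.
have e0 : 0 <= Num.sqrt A * 2 by rewrite mulr_ge0 // ltW.
rewrite -(@ler_pXn2r _ 2) ?nnegrE ?e0 ?(seminorm_ge0 sN) //.
by apply: le_trans (up _ sw) _; rewrite exprMn sA expr2; lra.
Qed.

End Cotype.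

(** * Restriction of scalars *)

Section Scalars.
Variables (R : realType) (k : scalar_kind).

(** The embedding of the real numbers into the scalars. *)
Definition real_scalar : R -> scalars R k :=
  match k return R -> scalars R k with
  | RealScalars => fun a => a
  | ComplexScalars => fun a => (a%:C)%C
  end.

Lemma real_scalarD a b : real_scalar (a + b) = real_scalar a + real_scalar b.
Proof. by rewrite /real_scalar; case: k => //; rewrite rmorphD. Qed.

Lemma real_scalarM a b : real_scalar (a * b) = real_scalar a * real_scalar b.
Proof. by rewrite /real_scalar; case: k => //; rewrite rmorphM. Qed.

Lemma real_scalar1 : real_scalar 1 = 1.
Proof. by rewrite /real_scalar; case: k. Qed.

Lemma real_scalar0 : real_scalar 0 = 0.
Proof. by rewrite /real_scalar; case: k. Qed.

Lemma real_scalar_int (z : int) : real_scalar z%:~R = z%:~R.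
Proof. by rewrite /real_scalar; case: k => //=; rewrite rmorph_int. Qed.

Lemma scalar_reD (a b : scalars R k) :
  scalar_re (a + b) = scalar_re a + scalar_re b.
Proof. by move: a b; rewrite /scalar_re; case: k => //= -[? ?] [? ?]. Qed.

Lemma scalar_re_real a : scalar_re (real_scalar a) = a.
Proof. by rewrite /scalar_re /real_scalar; case: k. Qed.

Lemma scalar_reM a (b : scalars R k) :
  scalar_re (real_scalar a * b) = a * scalar_re b.
Proof.
move: b; rewrite /scalar_re /real_scalar; case: k => //= -[x y] /=.
by rewrite mul0r subr0.
Qed.

Lemma real_scalar_norm a : `|real_scalar a| = real_scalar `|a|.
Proof.
by rewrite /real_scalar; case: k => //; rewrite normc_def /= expr0n addr0 sqrtr_sqr.
Qed.

Lemma real_scalar_re (a : scalars R k) : 0 <= a -> real_scalar (scalar_re a) = a.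
Proof.
move: a; rewrite /scalar_re /real_scalar; case: k => //= -[x y].
by rewrite lecE /= => /andP[/eqP -> _].
Qed.

Lemma ler_real_scalar a b : (real_scalar a <= real_scalar b) = (a <= b).
Proof. by rewrite /real_scalar; case: k => //=; rewrite lecR. Qed.

Lemma ltr_real_scalar a b : (real_scalar a < real_scalar b) = (a < b).
Proof. by rewrite /real_scalar; case: k => //=; rewrite ltcR. Qed.

Lemma ler_scalar_re (a b : scalars R k) : a <= b -> scalar_re a <= scalar_re b.
Proof.
move: a b; rewrite /scalar_re; case: k => //= -[x y] [z t].
by rewrite lecE /= => /andP[].
Qed.

Lemma scalar_re_ge0 (a : scalars R k) : 0 <= a -> 0 <= scalar_re a.
Proof.
by move: a; rewrite /scalar_re; case: k => //= -[x y]; rewrite lecE /= => /andP[].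
Qed.

End Scalars.
Arguments real_scalar {R k}.

(** A vector space over the scalars, seen as a real vector space. *)
Definition realify (R : realType) (k : scalar_kind)
  (X : lmodType (scalars R k)) : Type := X.

Section Realify.
Variables (R : realType) (k : scalar_kind) (X : lmodType (scalars R k)).

HB.instance Definition _ := GRing.Zmodule.on (realify X).

Let rscale (a : R) (x : realify X) : realify X := (real_scalar a : scalars R
  k) *: (x : X).

Let rscaleA a b v : rscale a (rscale b v) = rscale (a * b) v.
Proof. by rewrite /rscale scalerA real_scalarM. Qed.

Let rscale1 : left_id 1 rscale.
Proof. by move=> v; rewrite /rscale real_scalar1 scale1r. Qed.

Let rscaleDr : right_distributive rscale +%R.
Proof. by move=> a u v; rewrite /rscale scalerDr. Qed.

Let rscaleDl v : {morph rscale^~ v : a b / a + b}.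
Proof. by move=> a b; rewrite /rscale real_scalarD scalerDl. Qed.

HB.instance Definition _ := GRing.Zmodule_isLmodule.Build R (realify X)
  rscaleA rscale1 rscaleDr rscaleDl.

Lemma realify_scaleE (a : R) (x : realify X) :
  a *: x = (real_scalar a : scalars R k) *: (x : X) :> X.
Proof. by []. Qed.

(** Real linear combinations are in particular combinations of scalars. *)
Lemma realify_infinite : infinite_dimensional X ->
  infinite_dimensional (realify X).
Proof.
move=> hX [n [e he]]; apply: hX; exists n, e => x.
by have [c ->] := he x; exists (fun i => real_scalar (c i)).
Qed.

End Realify.

Section RealNorm.
Variables (R : realType) (k : scalar_kind) (X : normedModType (scalars R k)).

Lemma real_scalar_rnorm (x : X) : real_scalar (rnorm x) = `|x|.
Proof. by rewrite real_scalar_re. Qed.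

Lemma rnormZ (a : scalars R k) (x : X) :
  rnorm (a *: x) = scalar_re `|a| * rnorm x.
Proof. by rewrite /rnorm normrZ -[X in scalar_re (X * _)]real_scalar_re //
  scalar_reM. Qed.

Lemma rnorm_seminorm : @seminorm R (realify X) (@rnorm R k X).
Proof.
split=> [x y|a x].
  by rewrite /rnorm -scalar_reD; apply: ler_scalar_re; exact: ler_normD.
by rewrite realify_scaleE rnormZ real_scalar_norm scalar_re_real.
Qed.

Lemma rnorm0_eq0 (x : X) : rnorm x = 0 -> x = 0.
Proof.
move=> x0; apply/eqP.
by rewrite -normr_eq0 -real_scalar_rnorm x0 real_scalar0.
Qed.

End RealNorm.

Lemma real_linear_fun (R : realType) (k : scalar_kind)
    (X Y : normedModType (scalars R k)) (g : X -> Y) :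
  linear g -> exists u : {linear X -> Y}, forall x, u x = g x.
Proof.
move=> lg; pose gL := GRing.isLinear.Build (scalars R k) X Y *:%R g lg.
by pose u : {linear X -> Y} := HB.pack g gL; exists u.
Qed.

(** Over the complex numbers the functional is [f x - i * f (i * x)]. *)
Lemma complexify (R : realType) (k : scalar_kind)
    (X : normedModType (scalars R k)) (f : realify X -> R) :
  real_linear f -> (forall x, `|f x| <= rnorm (x : X)) ->
  exists phi : {linear X -> (scalars R k)^o}, forall x : X,
    `|f x| <= scalar_re `|phi x| /\ scalar_re `|phi x| <= 2 * rnorm x.
Proof.
case: k X f => X f lf fN.
  have [phi phiE] := @real_linear_fun R RealScalars X (scalars R
    RealScalars)^o f lf.
  exists phi => x; rewrite phiE; split => //=.
  apply: le_trans (fN x) _; rewrite ler_peMl ?ler1n //.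
  exact: (seminorm_ge0 (rnorm_seminorm X) x).
pose g (x : X) : (scalars R ComplexScalars)^o := (f x +i* - f ('i%C *: x))%C.
have lg : linear g.
  have key a b (x : X) : (a +i* b)%C *: x
      = (real_scalar a : scalars R ComplexScalars) *: x
        + (real_scalar b : scalars R ComplexScalars) *: ('i%C *: x : X).
    rewrite scalerA -scalerDl; congr (_ *: _).
    by apply/eqP; rewrite eq_complex /=; apply/andP; split; apply/eqP; ring.
  have keyi a b (x : X) : 'i%C *: ((a +i* b)%C *: x)
      = (real_scalar a : scalars R ComplexScalars) *: ('i%C *: x : X)
        + (real_scalar (- b) : scalars R ComplexScalars) *: x.
    rewrite !scalerA -scalerDl; congr (_ *: _).
    by apply/eqP; rewrite eq_complex /=; apply/andP; split; apply/eqP; ring.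
  move=> [a b] x y; rewrite /g.
  pose a' : R := a; pose b' : R := b.
  have E1 : (a +i* b)%C *: x + y
     = a' *: (x : realify X) + (b' *: (('i%C *: x) : realify X) + y) :> X.
    by rewrite key -addrA.
  have E2 : 'i%C *: ((a +i* b)%C *: x + y)
     = a' *: (('i%C *: x) : realify X) + ((- b') *: (x : realify X) + 'i%C *:
       y) :> X.
    by rewrite scalerDr keyi -addrA.
  rewrite E2 E1 !lf /a' /b'.
  by apply/eqP; rewrite eq_complex /=; apply/andP; split; apply/eqP; ring.
have [phi phiE] := @real_linear_fun R ComplexScalars X (scalars R
  ComplexScalars)^o g lg.
exists phi => x; rewrite phiE; pose ix : X := 'i%C *: x.
have -> : scalar_re (`|g x| : scalars R ComplexScalars)
   = Num.sqrt (f x ^+ 2 + f ix ^+ 2).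
  by rewrite [`|_|]normc_def /= sqrrN.
have h1 := fN x; have := fN ix.
have -> : rnorm ix = rnorm x.
  rewrite (@rnormZ R ComplexScalars X) [`|_|]normc_def /= expr0n expr1n add0r.
  by rewrite sqrtr1 mul1r.
move=> h2; have r0 := seminorm_ge0 (rnorm_seminorm X) x.
split.
  by rewrite -sqrtr_sqr ler_wsqrtr // lerDl sqr_ge0.
have -> : 2 * rnorm x = Num.sqrt ((2 * rnorm x) ^+ 2).
  by rewrite sqrtr_sqr ger0_norm // mulr_ge0.
apply: ler_wsqrtr; rewrite -(real_normK (num_real (f x))).
rewrite -(real_normK (num_real (f ix))).
have := normr_ge0 (f x); have := normr_ge0 (f ix).
move: h1 h2 r0; move: `|f x| `|f _| (rnorm x) => a b c; nra.
Qed.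

(** A continuous functional is controlled by its real and imaginary parts. *)
Lemma dual_real_parts (R : realType) (k : scalar_kind)
    (X : normedModType (scalars R k)) (phi : {linear X -> (scalars R k)^o}) :
  continuous phi -> exists (L : R) (f g : realify X -> R),
   [/\ 0 <= L, real_linear f, real_linear g &
     forall x : X, [/\ `|f x| <= L * rnorm x, `|g x| <= L * rnorm x,
       rnorm (phi x) <= `|f x| + `|g x| & rnorm (phi x) <= L * rnorm x]].
Proof.
move=> cphi.
have [L L0 phiL] : exists2 L : R, 0 <= L & forall x, rnorm (phi x) <= L * rnorm x.
  have /linear_bounded_continuous/linear_boundedP := cphi.
  move=> /pinfty_ex_gt0[r r0 hr].
  exists (scalar_re r).
    exact/scalar_re_ge0/ltW.
  move=> x; have := hr x; rewrite -!real_scalar_rnorm -[r]real_scalar_re;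
    last exact: ltW.
  by rewrite -real_scalarM ler_real_scalar scalar_re_real.
case: k X phi cphi phiL => X phi cphi phiL.
  exists L, phi, (fun=> 0); split => // [|a x y|x].
  - by move=> a x y; rewrite linearP.
  - by rewrite mulr0 addr0.
  - have h : `|phi x| <= L * rnorm x := phiL x; split => //.
      by rewrite normr0; apply: le_trans h.
    by rewrite normr0 addr0.
have phiR (a : R) (x y : realify X) : phi (a *: x + y) = (a%:C)%C * phi x + phi y.
  by rewrite realify_scaleE linearP.
exists L, (fun x => complex.Re (phi x)), (fun x => complex.Im (phi x)); split => //.
- by move=> a x y; rewrite phiR; case: (phi x) => ? ?;
    case: (phi y) => ? ? /=; ring.
- by move=> a x y; rewrite phiR; case: (phi x) => ? ?;
    case: (phi y) => ? ? /=; ring.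
have normE (z : (scalars R ComplexScalars)^o) :
    rnorm z = Num.sqrt (complex.Re z ^+ 2 + complex.Im z ^+ 2).
  by rewrite /rnorm [`|_|]normc_def.
move=> x; have := phiL x; rewrite !normE.
case: (phi x) => a b /= h; split => //.
- by apply: le_trans h; rewrite -sqrtr_sqr ler_wsqrtr // lerDl sqr_ge0.
- by apply: le_trans h; rewrite -sqrtr_sqr ler_wsqrtr // lerDr sqr_ge0.
- have -> : `|a| + `|b| = Num.sqrt ((`|a| + `|b|) ^+ 2).
    by rewrite sqrtr_sqr [RHS]ger0_norm // addr_ge0.
  apply: ler_wsqrtr; rewrite sqrrD !real_normK ?num_real // lerD2r lerDl.
  by rewrite mulrn_wge0 // mulr_ge0.
Qed.

(** * Rademacher functions *)

Section RademacherIntegral.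
Variable R : realType.

Lemma rademacher_pos k j (t : R) :
  (2 * j)%:R / 2 ^+ k.+1 < t < (2 * j).+1%:R / 2 ^+ k.+1 -> rademacher k.+1 t = 1.
Proof.
have p0 : 0 < 2 ^+ k.+1 :> R by rewrite exprn_gt0.
rewrite ltr_pdivrMr // ltr_pdivlMr // [t * _]mulrC => /andP[h1 h2].
pose s := 2 ^+ k.+1 * t - (2 * j)%:R.
have sE : 2 ^+ k.+1 * pi * t = s * pi + pi *+ 2 *+ j.
  by rewrite -mulrnA -[pi *+ _]mulr_natl /s; ring.
rewrite /rademacher sE (periodicn (@sinD2pi R)) gtr0_sgz // sin_gt0_pi //.
have s0 : 0 < s by rewrite subr_gt0.
have s1 : s < 1 by rewrite /s ltrBlDl natr1.
by rewrite mulr_gt0 ?pi_gt0 //= gtr_pMl ?pi_gt0.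
Qed.

Lemma rademacher_neg k j (t : R) :
  (2 * j).+1%:R / 2 ^+ k.+1 < t < (2 * j).+2%:R / 2 ^+ k.+1 ->
  rademacher k.+1 t = -1.
Proof.
have p0 : 0 < 2 ^+ k.+1 :> R by rewrite exprn_gt0.
rewrite ltr_pdivrMr // ltr_pdivlMr // [t * _]mulrC => /andP[h1 h2].
pose s := 2 ^+ k.+1 * t - (2 * j).+1%:R.
have sE : 2 ^+ k.+1 * pi * t = s * pi + pi + pi *+ 2 *+ j.
  by rewrite -mulrnA -[pi *+ _]mulr_natl /s -natr1; ring.
rewrite /rademacher sE (periodicn (@sinD2pi R)) sinDpi ltr0_sgz // oppr_lt0.
apply: sin_gt0_pi.
have s0 : 0 < s by rewrite subr_gt0.
have s1 : s < 1 by rewrite /s ltrBlDl natr1.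
by rewrite mulr_gt0 ?pi_gt0 //= gtr_pMl ?pi_gt0.
Qed.

Variable V : lmodType R.

(** The combination of the vectors of [ys] with the Rademacher functions
    numbered from [k + 1]. *)
Fixpoint rademacher_sum k (ys : seq V) (t : R) : V :=
  if ys is y :: ys' then
    (rademacher k.+1 t)%:~R *: y + rademacher_sum k.+1 ys' t
  else 0.

Lemma rademacher_sumE k ys t : rademacher_sum k ys t =
  \sum_(0 <= i < size ys) (rademacher (k + i).+1 t)%:~R *: nth 0 ys i.
Proof.
elim: ys k => [|y ys IHys] k /=; first by rewrite big_geq.
rewrite big_nat_recl // addn0 IHys; congr (_ + _).
by apply: eq_bigr => i _; rewrite addSnnS.
Qed.

(** The first Rademacher function occurring in the sum has opposite constant
    values on the two halves of a dyadic interval. *)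
Lemma integral_rademacher_sum ys (h : V -> R) k j : (forall v, 0 <= h v) ->
  let D : set R := [set` `]j%:R / 2 ^+ k, j.+1%:R / 2 ^+ k[] in
  let F t := h (rademacher_sum k ys t) in
  measurable_fun D F /\
  (\int[@lebesgue_measure R]_(t in D) (F t)%:E = (2 ^- k * ravg ys h)%R%:E)%E.
Proof.
elim: ys h k j => [|y ys IHys] h k j h0 D F.
  split; first by rewrite /F /=; exact: measurable_cst.
  rewrite /F /= integral_cst; last exact: measurable_itv.
  rewrite [X in (_ * X)%E](lebesgue_measure_itv _) /= lte_fin.
  have p0 : 0 < 2 ^+ k :> R by rewrite exprn_gt0.
  rewrite ltr_pM2r ?invr_gt0 // ltr_nat ltnSn -EFinB -EFinM -mulrBl.
  by rewrite -natr1 addrAC subrr add0r mul1r mulrC.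
have p0 : 0 < 2 ^+ k.+1 :> R by rewrite exprn_gt0.
pose a : R := (2 * j)%:R / 2 ^+ k.+1.
pose b : R := (2 * j).+1%:R / 2 ^+ k.+1.
pose c : R := (2 * j).+2%:R / 2 ^+ k.+1.
have ab : a < b by rewrite ltr_pM2r ?invr_gt0 // ltr_nat.
have bc : b < c by rewrite ltr_pM2r ?invr_gt0 // ltr_nat.
have cE l : l%:R / 2 ^+ k = (2 * l)%:R / 2 ^+ k.+1 :> R.
  by rewrite natrM exprS invfM mulrACA divff ?mul1r // pnatr_eq0.
have DE : D = `]a, c[%classic by rewrite /D !cE mulnS.
have IH1 := IHys (fun v => h (y + v)) k.+1 (2 * j)%N (fun v => h0 _).
have := IHys (fun v => h (- y + v)) k.+1 (2 * j).+1 (fun v => h0 _).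
rewrite /= -/a -/b -/c in IH1 * => -[m2 i2]; have [m1 i1] := IH1.
have F1 : {in `]a, b[, F =1 fun t => h (y + rademacher_sum k.+1 ys t)}.
  by move=> t; rewrite in_itv /= => /rademacher_pos tE; rewrite /F /= tE scale1r.
have F2 : {in `]b, c[, F =1 fun t => h (- y + rademacher_sum k.+1 ys t)}.
  by move=> t; rewrite in_itv /= => /rademacher_neg tE; rewrite /F /= tE scaleN1r.
have mF1 : measurable_fun `]a, b[ F.
  by apply: eq_measurable_fun m1 => t; rewrite inE /= => /F1.
have mF2 : measurable_fun `]b, c[ F.
  by apply: eq_measurable_fun m2 => t; rewrite inE /= => /F2.
have mF2' : measurable_fun `[b, c[ F by apply/measurable_fun_itv_obnd_cbndP.
have U : `]a, c[%classic = `]a, b[%classic `|` `[b, c[%classic.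
  by apply: itv_bndbnd_setU; rewrite bnd_simp // ltW.
have mF : measurable_fun D F by rewrite DE U; apply/measurable_funU.
split => //; rewrite DE U ge0_integral_setU //.
- rewrite (@integral_itv_bndoo _ b c _ true true); last exact/measurable_EFinP.
  have -> : (\int[@lebesgue_measure R]_(t in `]a, b[) (F t)%:E)%E =
      (2 ^- k.+1 * ravg ys (fun v => h (y + v)))%:E.
    by rewrite -i1; apply: eq_integral => t; rewrite inE => /F1 ->.
  have -> : (\int[@lebesgue_measure R]_(t in `]b, c[) (F t)%:E)%E =
      (2 ^- k.+1 * ravg ys (fun v => h (- y + v)))%:E.
    by rewrite -i2; apply: eq_integral => t; rewrite inE => /F2 ->.
  by rewrite -EFinD exprS invfM /=; congr EFin; ring.
- by apply/measurable_EFinP; rewrite -U -DE.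
- by move=> t _; rewrite lee_fin; exact: h0.
- apply/disj_set2P/seteqP; split => // t [] /=; rewrite !in_itv /=.
  by move=> /andP[_ h1] /andP[/(lt_le_trans h1)]; rewrite ltxx.
Qed.
End RademacherIntegral.

Lemma integral_rademacher (R : realType) (k : scalar_kind)
    (Y : normedModType (scalars R k)) (n : nat) (y : 'I_n -> Y) :
  \int[@lebesgue_measure R]_(t in `[0, 1])
    (rnorm (\sum_(i < n) (rademacher i.+1 t)%:~R *: y i)) ^+ 2 =
  rademacher_sq (@rnorm R k Y : realify Y -> R) [seq y i | i <- enum 'I_n].
Proof.
set ys : seq (realify Y) := [seq y i | i <- enum 'I_n].
pose N2 (v : realify Y) : R := rnorm (v : Y) ^+ 2.
have sumE t : \sum_(i < n) (rademacher i.+1 t)%:~R *: y i = rademacher_sum 0 ys t.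
  rewrite rademacher_sumE size_map size_enum_ord big_mkord.
  apply: eq_bigr => i _; rewrite realify_scaleE real_scalar_int; congr (_ *: _).
  by rewrite (nth_map i) ?size_enum_ord // nth_ord_enum.
under eq_Rintegral do rewrite sumE.
have [mF] := @integral_rademacher_sum R (realify Y) ys N2 0 0 (fun v => sqr_ge0 _).
rewrite expr0 !divr1 => intF.
rewrite /Rintegral (@integral_itv_bndoo _ 0 1 _ true false).
  by rewrite intF /= invr1 mul1r.
by apply/measurable_EFinP; move: mF; rewrite expr0 !divr1.
Qed.

(** A cotype inequality for Rademacher averages contradicts the absence of
    finite cotype, with exponent [2 * r]. *)
Lemma no_finite_cotype_averages (R : realType) (k : scalar_kind)
    (Y : normedModType (scalars R k)) (r : nat) (C : R) :
  no_finite_cotype Y -> (0 < r)%N -> 0 <= C ->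
  ~ forall ys : seq (realify Y), \sum_(y <- ys) rnorm (y : Y) ^+ 2 ^+ r <=
      C * rademacher_sq (@rnorm R k Y : realify Y -> R) ys ^+ r.
Proof.
move=> noC r0 C0 cot.
pose s : R := (2 * r)%:R.
have s2 : 2 <= s by rewrite ler_nat leq_pmulr.
apply: (noC s s2); exists (C `^ s^-1); first exact: powR_ge0.
move=> n y; rewrite integral_rademacher.
set ys : seq (realify Y) := map _ _.
set A := rademacher_sq _ _.
have sY := rnorm_seminorm Y.
have A0 : 0 <= A := rademacher_sq_ge0 sY ys.
have s0 : 0 < s by apply: lt_le_trans s2.
have -> : A `^ 2^-1 = (A ^+ r) `^ s^-1.
  rewrite -powR_mulrn // -powRrM; congr (_ `^ _).
  rewrite /s natrM invfM mulrCA divff ?mulr1 //.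
  by rewrite pnatr_eq0 -lt0n.
rewrite -powRM ?exprn_ge0 //.
apply: ge0_ler_powR.
- by rewrite invr_ge0 ltW.
- by rewrite nnegrE sumr_ge0 // => i _; exact: powR_ge0.
- by rewrite nnegrE mulr_ge0 // exprn_ge0.
apply: le_trans (cot ys); rewrite big_map big_enum /=.
apply: ler_sum => i _.
by rewrite /s powR_mulrn ?exprM //; exact: (seminorm_ge0 sY).
Qed.

(** * Finite-rank blocks *)

Lemma cauchy_limit (R : realType) (k : scalar_kind)
    (Y : completeNormedModType (scalars R k)) (v : nat -> Y) (c : nat -> R) :
  (forall n l, (n <= l)%N -> rnorm (v l - v n) <= c n) ->
  (forall e, 0 < e -> exists n, c n < e) ->
  exists y, forall n, rnorm (y - v n) <= c n.
Proof.
move=> vc c0.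
have symn (x y : Y) : rnorm (x - y) = rnorm (y - x) by rewrite /rnorm distrC.
have cv : cvg (v @ \oo).
  apply: cauchy_cvg; apply: cauchy_exP => e e0.
  have eE := real_scalar_re (ltW e0).
  have [|n cn] := c0 (scalar_re e).
    by rewrite -(ltr_real_scalar k) eE real_scalar0.
  exists (v n); exists n => // l /= nl.
  rewrite -ball_normE /= -real_scalar_rnorm -eE ltr_real_scalar symn.
  exact: le_lt_trans (vc _ _ nl) cn.
exists (lim (v @ \oo)) => n; apply/ler_addgt0Pr => e e0.
have e0' : 0 < (real_scalar e : scalars R k).
  by rewrite -(real_scalar0 R k) ltr_real_scalar.
have /cvgrPdist_lt/(_ _ e0')[l0 _ hl0] := cv.
have := hl0 (maxn n l0) (leq_maxr _ _).
rewrite /= -real_scalar_rnorm ltr_real_scalar => h1.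
have h2 := vc n (maxn n l0) (leq_maxl _ _).
have := seminorm_ler (rnorm_seminorm Y) (lim (v @ \oo) - v (maxn n l0))
  (v (maxn n l0) - v n).
rewrite addrA subrK => h3; apply: le_trans h3 _; rewrite addrC.
by apply: lerD => //; apply: ltW.
Qed.

Lemma combination_le (R : realType) (V : lmodType R) (N : V -> R) m
    (y : 'I_m -> V) (C M : R) (b : 'I_m -> R) : seminorm N -> 0 <= M ->
  (forall a : 'I_m -> R, (forall i, `|a i| <= 1) ->
     N (\sum_(i < m) a i *: y i) <= C) ->
  (forall i, `|b i| <= M) -> N (\sum_(i < m) b i *: y i) <= M * C.
Proof.
move=> sN; rewrite le_eqVlt => /predU1P[<-|M0] yC bM.
  rewrite big1 ?(seminorm0 sN) ?mul0r // => i _.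
  by have := bM i; rewrite normr_le0 => /eqP ->; rewrite scale0r.
have -> : \sum_(i < m) b i *: y i = M *: \sum_(i < m) (b i / M) *: y i.
  rewrite scaler_sumr; apply: eq_bigr => i _.
  by rewrite scalerA mulrCA divff ?mulr1 ?gt_eqF.
rewrite (seminormZ sN) gtr0_norm // ler_wpM2l ?(ltW M0) //;
  apply: (yC (fun i => b i / M)) => i.
by rewrite normrM normfV (gtr0_norm M0) ler_pdivrMr // mul1r.
Qed.

(** Splitting complex coefficients in real and imaginary parts costs a factor
    two. *)
Lemma scalar_combination_le (R : realType) (k : scalar_kind)
    (Y : normedModType (scalars R k)) m (y : 'I_m -> Y) (C M : R)
    (b : 'I_m -> (scalars R k)^o) : 0 <= C -> 0 <= M ->
  (forall a : 'I_m -> R, (forall i, `|a i| <= 1) ->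
     rnorm (\sum_(i < m) a i *: (y i : realify Y) : Y) <= C) ->
  (forall i, rnorm (b i) <= M) -> rnorm (\sum_(i < m) b i *: y i) <= 2 * (M * C).
Proof.
move=> C0 M0 yC bM.
have sY := rnorm_seminorm Y.
have MC0 : 0 <= M * C by rewrite mulr_ge0.
case: k Y y b sY yC bM => Y y b sY yC bM.
  have h : rnorm (\sum_(i < m) b i *: y i) <= M * C := combination_le sY M0 yC bM.
  by apply: le_trans h _; rewrite ler_peMl ?ler1n.
have normE (z : (scalars R ComplexScalars)^o) :
    rnorm z = Num.sqrt (complex.Re z ^+ 2 + complex.Im z ^+ 2).
  by rewrite /rnorm [`|_|]normc_def.
pose S1 : Y := \sum_(i < m) complex.Re (b i) *: (y i : realify Y).
pose S2 : Y := \sum_(i < m) complex.Im (b i) *: (y i : realify Y).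
have -> : \sum_(i < m) b i *: y i = S1 + 'i%C *: S2.
  rewrite /S1 /S2 scaler_sumr -big_split; apply: eq_bigr => i _ /=.
  rewrite !realify_scaleE scalerA -scalerDl; congr (_ *: _).
  by case: (b i) => p q; apply/eqP; rewrite eq_complex /=; apply/andP; split;
    apply/eqP; ring.
have h1 : rnorm S1 <= M * C.
  apply: (combination_le sY M0 yC) => i; apply: le_trans (bM i).
  by rewrite normE -sqrtr_sqr ler_wsqrtr // lerDl sqr_ge0.
have h2 : rnorm S2 <= M * C.
  apply: (combination_le sY M0 yC) => i; apply: le_trans (bM i).
  by rewrite normE -sqrtr_sqr ler_wsqrtr // lerDr sqr_ge0.
have h3 : rnorm ('i%C *: S2 : Y) = rnorm S2.
  rewrite (@rnormZ R ComplexScalars Y) [`|_|]normc_def /= expr0n expr1n add0r.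
  by rewrite sqrtr1 mul1r.
by have := seminorm_ler sY S1 ('i%C *: S2 : Y); rewrite h3; lra.
Qed.

Section Signs.
Variables (R : realType) (V : lmodType R) (N : V -> R).
Hypothesis sN : seminorm N.

(** For a random choice of signs each index [i] is good with probability at
    least one half, since flipping the sign [e i] moves the vector by twice
    [t i i]. *)
Lemma sign_choice m (b : 'I_m -> V) (t : 'I_m -> 'I_m -> V) :
  exists e : 'I_m -> bool, (m <= 2 *
    #|[pred i | (N (t i i) <= N (b i + \sum_(j < m) (-1) ^+ e j *: t i j))%R]|)%N.
Proof.
pose good (e : {ffun 'I_m -> bool}) i : bool :=
  N (t i i) <= N (b i + \sum_(j < m) (-1) ^+ e j *: t i j).
pose flip i (e : {ffun 'I_m -> bool}) : {ffun 'I_m -> bool} :=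
  [ffun j => if j == i then ~~ e j else e j].
have flipK i : involutive (flip i).
  move=> e; apply/ffunP => j; rewrite !ffunE; case: eqP => //= _.
  by rewrite negbK.
have good_flip e i : (0 < good e i + good (flip i e) i)%N.
  suff : good e i || good (flip i e) i by case: (good e i); case: (good _ i).
  rewrite /good !(bigD1 i (P := predT)) //= ffunE eqxx.
  have -> : \sum_(j < m | j != i) (-1) ^+ flip i e j *: t i j
      = \sum_(j < m | j != i) (-1) ^+ e j *: t i j.
    by apply: eq_bigr => j /negbTE ji; rewrite ffunE ji.
  rewrite signrN scaleNr; set s := (-1) ^+ e i *: t i i;
    set r := \sum_(j < m | _) _.
  have -> : b i + (s + r) = (b i + r) + s by rewrite [s + r]addrC addrA.
  have -> : b i + (- s + r) = (b i + r) - s by rewrite [- s + r]addrC addrA.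
  have Ns : N s = N (t i i) by rewrite (seminormZ sN) normrX normrN1 expr1n mul1r.
  have := seminorm_pair sN s (b i + r); rewrite Ns => h.
  case: leP => //= h1; rewrite leNgt; apply/negP => h2.
  by move: h; rewrite leNgt => /negP; apply; lra.
apply: contrapT => noe.
have lt_e (e : {ffun 'I_m -> bool}) : (2 * \sum_(i < m) good e i < m)%N.
  rewrite ltnNge; apply/negP => me; apply: noe; exists e.
  by rewrite -sum1_card [X in (_ <= 2 * X)%N]big_mkcond.
have flip_sum : (\sum_e \sum_(i < m) (good e i + good (flip i e) i) =
    \sum_e 2 * \sum_(i < m) good e i)%N.
  under eq_bigr do rewrite big_split /=.
  rewrite big_split /=.
  have -> : (\sum_e \sum_(i < m) good (flip i e) i = \sum_e \sum_(i < m) good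
    e i)%N.
    rewrite exchange_big [RHS]exchange_big /=; apply: eq_bigr => i _.
    by rewrite [RHS](reindex_inj (inv_inj (flipK i))).
  by rewrite -big_split; apply: eq_bigr => e _ /=; rewrite mul2n addnn.
have : (\sum_(e : {ffun 'I_m -> bool}) m <= \sum_e 2 * \sum_(i < m) good e i)%N.
  rewrite -flip_sum; apply: leq_sum => e _.
  rewrite -{1}[m]card_ord -sum1_card; apply: leq_sum => i _; exact: good_flip.
rewrite leqNgt => /negP; apply.
rewrite (bigD1 [ffun=> true]) //= [X in (_ < X)%N](bigD1 [ffun=> true]) //=.
rewrite -addSn leq_add ?lt_e //; apply: leq_sum => e _; exact/ltnW/lt_e.
Qed.

End Signs.

Section Block.
Variables (R : realType) (k : scalar_kind).
Variables (X Y : normedModType (scalars R k)).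
Hypothesis X_inf : infinite_dimensional X.
Hypothesis Y_no_cotype : forall r (C : R), (0 < r)%N -> 0 <= C ->
  ~ forall ys : seq (realify Y), \sum_(y <- ys) rnorm (y : Y) ^+ 2 ^+ r <=
      C * rademacher_sq (@rnorm R k Y : realify Y -> R) ys ^+ r.

(** Vectors with small weak summing norm, such that any map [v] can be made
    large on at least half of them by adding a small multiple of a suitable
    operator. *)
Lemma block m : exists x : 'I_m -> X,
  [/\ forall i, rnorm (x i) <= 1,
      forall (f : realify X -> R) (L : R), 0 <= L -> real_linear f ->
        (forall z, `|f z| <= L * rnorm (z : X)) ->
        \sum_(i < m) `|f (x i)| <= L * Num.sqrt m%:R &
      forall (v : X -> Y) (c : R), 0 < c -> exists w : {linear X -> Y},
        (forall z, rnorm (w z) <= 8 * rnorm z) /\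
        (m <= 2 * #|[pred i | (c / 8 <=
           rnorm (v (x i) + real_scalar c *: w (x i)))%R]|)%N].
Proof.
have sX := rnorm_seminorm X; have sY := rnorm_seminorm Y.
have [x [xlow xup]] := dvoretzky_rogers m (realify_infinite X_inf) sX
  (@rnorm0_eq0 R k X).
exists x; split.
- move=> i; have := xup (fun j => (j == i)%:R).
  rewrite (bigD1 i) //= big1 ?addr0 => [|j /negbTE ->]; last by rewrite scale0r.
  rewrite (bigD1 i) //= big1 ?addr0 => [|j /negbTE ->]; last by rewrite expr0n.
  by rewrite eqxx scale1r expr1n sqrtr1.
- move=> f L L0 lf fL.
  have -> : \sum_(i < m) `|f (x i)| = f (\sum_(i < m) Num.sg (f (x i)) *: x i).
    rewrite real_linear_sum //; apply: eq_bigr => i _.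
    by rewrite real_linearZ // normrEsg.
  apply: le_trans (ler_norm _) _; apply: le_trans (fL _) _.
  apply: ler_wpM2l => //; apply: le_trans (xup _) _; apply: ler_wsqrtr.
  have -> : m%:R = \sum_(i < m) (1 : R) by rewrite sumr_const card_ord.
  apply: ler_sum => i _; rewrite -(real_normK (num_real _)) exprn_ile1 //.
  by rewrite normr_sg; case: eqP.
- move=> v c c0.
  have [y [ylow yup]] := no_cotype_bounded_combinations sY m Y_no_cotype.
  have [i|phi phiP] := @choice _ _ (fun i (p : {linear X -> (scalars R k)^o}) =>
      (forall z, rnorm (p z) <= 2 * rnorm z) /\ 4^-1 <= rnorm (p (x i))).
    have [f [lf fN fx]] := hahn_banach (x i) sX.
    have [p hp] := complexify lf fN.
    exists p; split => [z|]; first by have [] := hp z.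
    have [h _] := hp (x i); apply: le_trans h.
    by rewrite fx ger0_norm ?xlow // (seminorm_ge0 sX).
  pose t i j : realify Y := c *: (phi j (x i) *: y j : realify Y).
  have [e he] := sign_choice sY (fun i => v (x i) : realify Y) t.
  pose w z : Y := \sum_(j < m) ((real_scalar ((-1) ^+ e j) : scalars R k) *
    phi j z) *: y j.
  have lw : linear w.
    move=> a z z'; rewrite /w scaler_sumr -big_split; apply: eq_bigr => j _ /=.
    by rewrite linearP scalerA mulrDr scalerDl mulrCA.
  have [u uE] := real_linear_fun lw.
  exists u; split => [z|].
    rewrite uE /w.
    have -> : 8 * rnorm z = 2 * ((2 * rnorm z) * 2) by ring.
    apply: scalar_combination_le => // [|j].
      by rewrite mulr_ge0 // (seminorm_ge0 sX).
    have [h _] := phiP j; apply: le_trans (h z).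
    rewrite (@rnormZ R k (scalars R k)^o) real_scalar_norm scalar_re_real
      normrX normrN1 expr1n.
    by rewrite mul1r.
  apply: leq_trans he _; rewrite leq_mul2l /=.
  apply/subset_leq_card/fintype.subsetP => i; rewrite !inE => hi.
  have -> : v (x i) + real_scalar c *: u (x i) =
      v (x i) + \sum_(j < m) (-1) ^+ e j *: t i j :> Y.
    congr (_ + _); rewrite uE /w scaler_sumr; apply: eq_bigr => j _.
    have -> : (-1) ^+ e j *: t i j = (real_scalar ((-1) ^+ e j) : scalars R k) *:
        ((real_scalar c : scalars R k) *: (phi j (x i) *: (y j : Y))) :> Y by [].
    by rewrite !scalerA; congr (_ *: _); rewrite mulrA [_ * real_scalar _]mulrC.
  apply: le_trans hi; rewrite /t (seminormZ sY) (@rnormZ R k Y) gtr0_norm //.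
  rewrite ler_pM2l //; have [_ h1] := phiP i; have h2 := ylow i.
  have -> : 8^-1 = 4^-1 * 2^-1 :> R by rewrite -invfM -natrM.
  by apply: ler_pM; rewrite ?invr_ge0.
Qed.

End Block.

(** * Gluing the blocks *)

Section Concat.
Variables (T : Type) (x0 : T) (L : nat -> seq T).
Hypothesis L0 : forall k, (0 < size (L k))%N.

(** The finite list [L 0 ++ ... ++ L (K - 1)]. *)
Fixpoint concat_blocks K : seq T :=
  if K is K'.+1 then concat_blocks K' ++ L K' else [::].

(** The infinite concatenation of the nonempty lists [L 0], [L 1], ... *)
Definition concat_seq j : T := nth x0 (concat_blocks j.+1) j.

Lemma leq_size_concat K : (K <= size (concat_blocks K))%N.
Proof.
by elim: K => //= K IHK; rewrite size_cat; have := L0 K; lia.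
Qed.

Lemma nth_concat K j : (j < size (concat_blocks K))%N ->
  nth x0 (concat_blocks K) j = concat_seq j.
Proof.
have step d J : (j < size (concat_blocks J))%N ->
    nth x0 (concat_blocks (J + d)) j = nth x0 (concat_blocks J) j.
  move=> jJ; elim: d => [|d IHd]; first by rewrite addn0.
  rewrite addnS /= nth_cat ifT ?IHd //; apply: leq_trans jJ _.
  by elim: d {IHd} => [|d IHd]; rewrite ?addn0 // addnS /= size_cat (leq_trans
    IHd) ?leq_addr.
move=> jK; have jj : (j < size (concat_blocks j.+1))%N := leq_size_concat j.+1.
by rewrite /concat_seq -(step j.+1 K jK) addnC step.
Qed.

Lemma sum_concat (R : realType) (f : T -> R) K :
  \sum_(0 <= j < size (concat_blocks K)) f (concat_seq j) =
  \sum_(k < K) \sum_(z <- L k) f z.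
Proof.
transitivity (\sum_(z <- concat_blocks K) f z).
  rewrite (big_nth x0); apply: eq_big_nat => j jK.
  by rewrite nth_concat.
elim: K => [|K IHK]; first by rewrite big_nil big_ord0.
by rewrite big_ord_recr /= big_cat IHK.
Qed.

End Concat.

Lemma nneseries_bounded (R : realType) (f : nat -> R) (B : R) :
  (forall j, 0 <= f j) -> (forall n, \sum_(0 <= j < n) f j <= B) ->
  (\sum_(0 <= j <oo) (f j)%:E < +oo)%E.
Proof.
move=> f0 fB; apply: (@le_lt_trans _ _ B%:E); last exact: ltry.
apply: lime_le; first by apply: is_cvg_nneseries => n _ _; rewrite lee_fin.
by apply: nearW => n; rewrite sumEFin lee_fin.
Qed.

Lemma nneseries_partial (R : realType) (f : nat -> R) :
  (forall j, 0 <= f j) -> (\sum_(0 <= j <oo) (f j)%:E < +oo)%E ->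
  exists B, forall n, \sum_(0 <= j < n) f j <= B.
Proof.
move=> f0 foo; exists (fine (\sum_(0 <= j <oo) (f j)%:E)) => n.
rewrite -lee_fin fineK; last first.
  by rewrite ge0_fin_numE // nneseries_ge0 // => j _ _; rewrite lee_fin.
rewrite -sumEFin; apply: nneseries_lim_ge => j _ _; by rewrite lee_fin.
Qed.

Lemma bounded_continuous (R : realType) (k : scalar_kind)
    (X Y : normedModType (scalars R k)) (u : {linear X -> Y}) (C : R) :
  (forall x, rnorm (u x) <= C * rnorm x) -> continuous u.
Proof.
move=> uC; apply/linear_bounded_continuous/linear_boundedP.
have CR : (real_scalar C : scalars R k) \is Num.real.
  have [C0|C0] := leP 0 C.
    by rewrite ger0_real // -(real_scalar0 R k) ler_real_scalar.
  by rewrite ler0_real // -(real_scalar0 R k) ler_real_scalar ltW.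
exists (real_scalar C); split => // r Cr x.
rewrite -!real_scalar_rnorm; apply: (@le_trans _ _ (real_scalar (C * rnorm x))).
  by rewrite ler_real_scalar.
rewrite real_scalarM ler_wpM2r ?(ltW Cr) //.
by rewrite -(real_scalar0 R k) ler_real_scalar (seminorm_ge0 (rnorm_seminorm X)).
Qed.

Section Limit.
Variables (R : realType) (k : scalar_kind).
Variables (X : normedModType (scalars R k)).
Variables (Y : completeNormedModType (scalars R k)).
Variables (rho : R) (w : nat -> {linear X -> Y}).
Hypotheses (rho0 : 0 < rho) (rho_small : 144 * rho <= 1).
Hypothesis wle : forall n x, rnorm (w n x) <= 8 * rnorm x.

(** A bound for the tail [8 * (rho ^ n + rho ^ (n + 1) + ...)]. *)
Definition tail_bound (n : nat) : R := 9 * rho ^+ n.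

Lemma tail_bound_ge0 n : 0 <= tail_bound n.
Proof. by rewrite /tail_bound mulr_ge0 // exprn_ge0 // ltW. Qed.

Lemma tail_boundS n : 8 * rho ^+ n <= tail_bound n - tail_bound n.+1.
Proof.
rewrite /tail_bound exprS.
have : 144 * rho * rho ^+ n <= 1 * rho ^+ n.
  by rewrite ler_wpM2r // exprn_ge0 // ltW.
have : 0 <= rho * rho ^+ n by rewrite mulr_ge0 ?exprn_ge0 // ltW.
by rewrite -mulrA mul1r; move: (rho ^+ n) (rho * _) => a b; lra.
Qed.

Lemma tail_bound_small (C e : R) : 0 < e -> exists n, tail_bound n * C < e.
Proof.
move=> e0; pose D := 9 * (`|C| + 1).
have D0 : 0 < D by rewrite mulr_gt0 // ltr_wpDl.
have rho01 : 0 < rho < 1 by rewrite rho0 /=; have := rho0; have := rho_small; lra.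
have eD0 : 0 < e / D / 2 by rewrite !divr_gt0.
have [n hn] := geometric_small rho01 eD0.
exists n; apply: (@le_lt_trans _ _ (D * rho ^+ n)).
  rewrite /tail_bound /D mulrAC; apply: ler_wpM2r;
    first by rewrite exprn_ge0 // ltW.
  apply: ler_wpM2l => //.
  by apply: le_trans (ler_norm C) _; rewrite lerDl.
have : D * rho ^+ n <= D * (e / D / 2) by rewrite ler_pM2l.
have -> : D * (e / D / 2) = e / 2 by rewrite mulrA mulrCA divff ?mulr1 ?gt_eqF.
by move/le_lt_trans; apply; lra.
Qed.

(** The partial sums of the series of the operators [rho ^ n * w n]. *)
Fixpoint partial_op n (x : X) : Y :=
  if n is n'.+1 then
    partial_op n' x + (real_scalar (rho ^+ n') : scalars R k) *: w n' x
  else 0.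

Lemma partial_op_linear n : linear (partial_op n).
Proof.
move=> a x y; elim: n => [|n IHn] /=; first by rewrite scaler0 addr0.
rewrite IHn linearP !scalerDr !scalerA addrACA; congr (_ + _ + _).
by rewrite mulrC.
Qed.

Lemma partial_op_cauchy n l x : (n <= l)%N ->
  rnorm (partial_op l x - partial_op n x) <= tail_bound n * rnorm x.
Proof.
have sY := rnorm_seminorm Y.
have r0 : 0 <= rnorm x := seminorm_ge0 (rnorm_seminorm X) x.
move=> /subnKC <-; set d := (l - n)%N.
suff : rnorm (partial_op (n + d) x - partial_op n x) <=
    (tail_bound n - tail_bound (n + d)) * rnorm x.
  move=> h; apply: le_trans h _; rewrite ler_wpM2r // gerBl.
  exact: tail_bound_ge0.
elim: {l}d => [|d IHd]; first by rewrite addn0 !subrr mul0r (seminorm0 sY).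
rewrite addnS /= addrAC.
apply: le_trans (seminorm_ler sY _ _) _.
have h : rnorm ((real_scalar (rho ^+ (n + d)) : scalars R k) *: w (n + d)%N x)
    <= rho ^+ (n + d) * (8 * rnorm x).
  rewrite rnormZ real_scalar_norm scalar_re_real ger0_norm; last first.
    by rewrite exprn_ge0 // ltW.
  by rewrite ler_wpM2l // exprn_ge0 // ltW.
apply: le_trans (lerD IHd h) _.
rewrite mulrA -mulrDl ler_wpM2r // [rho ^+ _ * 8]mulrC.
by have := tail_boundS (n + d); lra.
Qed.

(** The partial sums converge pointwise to a bounded operator. *)
Lemma partial_op_limit : exists u : {linear X -> Y}, continuous u /\
  forall n x, rnorm (u x - partial_op n x) <= tail_bound n * rnorm x.
Proof.
have sY := rnorm_seminorm Y.
have [x|g gP] := @choice _ _ (fun x y => forall n,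
    rnorm (y - partial_op n x) <= tail_bound n * rnorm x).
  apply: cauchy_limit => [n l nl|e]; first exact: partial_op_cauchy.
  exact: tail_bound_small.
have lg : linear g.
  move=> a x y; apply/eqP; rewrite -subr_eq0; apply/eqP/rnorm0_eq0.
  (* the defect of linearity of the limit is smaller than each [e] *)
  apply/eqP; rewrite eq_le (seminorm_ge0 sY) andbT; apply/ler_addgt0Pr => e e0.
  rewrite add0r.
  pose C := rnorm (a *: x + y) + scalar_re `|a| * rnorm x + rnorm y.
  have [n hn] := tail_bound_small C e0.
  apply: ltW; apply: le_lt_trans hn.
  have -> : g (a *: x + y) - (a *: g x + g y) =
      (g (a *: x + y) - partial_op n (a *: x + y))
      - (a *: (g x - partial_op n x) + (g y - partial_op n y)).
    rewrite partial_op_linear scalerBr [X in _ = _ - X]addrACA.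
    by rewrite -opprD opprB addrA subrK.
  apply: le_trans (seminorm_ler sY _ _) _; rewrite (seminormN sY).
  have h1 := gP (a *: x + y) n.
  have h2 := seminorm_ler sY (a *: (g x - partial_op n x)) (g y - partial_op n y).
  have h3 : rnorm (a *: (g x - partial_op n x)) <=
      scalar_re `|a| * (tail_bound n * rnorm x).
    by rewrite rnormZ ler_wpM2l ?gP // scalar_re_ge0.
  have h4 := gP y n.
  rewrite /C !mulrDr; move: h1 h2 h3 h4.
  move: (tail_bound n) (scalar_re _) => t s h1 h2 h3 h4.
  have -> : t * (s * rnorm x) = s * (t * rnorm x) by ring.
  move: (rnorm x) (rnorm y) (rnorm (a *: x + y)) h1 h2 h3 h4 => p q r h1 h2 h3 h4.
  by rewrite -addrA; apply: lerD => //; apply: le_trans h2 _; apply: lerD.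
have [u uE] := real_linear_fun lg.
have ule x : rnorm (u x) <= tail_bound 0 * rnorm x.
  by have := gP x 0%N; rewrite subr0 uE.
exists u; split; first exact: bounded_continuous ule.
by move=> n x; rewrite uE.
Qed.

End Limit.

Section ScaledBlock.
Variables (R : realType) (k : scalar_kind).
Variables (X : normedModType (scalars R k)) (Y : normedModType (scalars R k)).
Hypothesis X_inf : infinite_dimensional X.
Hypothesis Y_no_cotype : no_finite_cotype Y.
Variables (p rho : R).
Hypothesis p1 : 1 <= p.
Hypotheses (rho0 : 0 < rho) (rho_small : 144 * rho <= 1).

(** A block of [q ^ 2] vectors scaled by [a], where [a ^ p = 1 / (2 ^ n q)]: its
    weak [p]-th power sums are of order [a ^ p * q = 2 ^ -n], while its strong
    sums are of order [a ^ p * q ^ 2 * rho ^ (n p)], which is at least one for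
    large [q]. *)
Lemma scaled_block n : exists (s : seq X) (W : (X -> Y) -> {linear X -> Y}),
  [/\ (0 < size s)%N,
      forall (phi : {linear X -> (scalars R k)^o}) (L : R) (f g : realify X -> R),
        0 <= L -> real_linear f -> real_linear g ->
        (forall x : X, [/\ `|f x| <= L * rnorm x, `|g x| <= L * rnorm x,
            rnorm (phi x) <= `|f x| + `|g x| & rnorm (phi x) <= L * rnorm x]) ->
        \sum_(z <- s) rnorm (phi z) `^ p <= 2 * L * (L + 1) `^ (p - 1) * 2^-1 ^+ n,
      forall v x, rnorm (W v x) <= 8 * rnorm x &
      forall (v : X -> Y) (u : {linear X -> Y}),
        (forall x, rnorm (u x - (v x + (real_scalar (rho ^+ n) : scalars R k)
          *: W v x)) <=
           tail_bound rho n.+1 * rnorm x) ->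
        1 <= \sum_(z <- s) rnorm (u z) `^ p].
Proof.
have sX := rnorm_seminorm X; have sY := rnorm_seminorm Y.
have p0 : 0 < p by apply: lt_le_trans p1.
have pn0 : p != 0 by rewrite gt_eqF.
have rn0 : 0 < rho ^+ n by rewrite exprn_gt0.
pose h : R := (rho ^+ n / 16) `^ p.
have h0 : 0 < h by rewrite powR_gt0 // divr_gt0.
have pow2 : 0 < 2 ^+ n :> R by rewrite exprn_gt0.
pose q := Num.bound (2 * 2 ^+ n / h).
have hq : 2 * 2 ^+ n < q%:R * h.
  rewrite -ltr_pdivrMr //; apply: archi_boundP.
  by rewrite ltW // divr_gt0 // mulr_gt0.
have q0 : 0 < q%:R :> R.
  by rewrite -(pmulr_lgt0 _ h0); apply: lt_trans hq; rewrite mulr_gt0.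
pose a : R := (2 ^+ n * q%:R)^-1 `^ p^-1.
have ap : a `^ p = (2 ^+ n * q%:R)^-1.
  by rewrite /a -powRrM mulVf // powRr1 // invr_ge0 ltW // mulr_gt0.
have a0 : 0 <= a by rewrite powR_ge0.
have [x [xle xweak xstrong]] := block X_inf
  (fun r C => @no_finite_cotype_averages R k Y r C Y_no_cotype) (q ^ 2)%N.
have [W WP] := @choice _ _ (fun v (w : {linear X -> Y}) =>
    (forall z, rnorm (w z) <= 8 * rnorm z) /\
        (q ^ 2 <= 2 * #|[pred i | (rho ^+ n / 8 <=
           rnorm (v (x i) + real_scalar (rho ^+ n) *: w (x i)))%R]|)%N)
    (fun v => xstrong v _ rn0).
pose s : seq X := [seq (real_scalar a : scalars R k) *: x i | i <- enum 'I_(q ^ 2)].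
have sumE (Z : normedModType (scalars R k)) (u : {linear X -> Z}) :
    \sum_(z <- s) rnorm (u z) `^ p =
    (2 ^+ n * q%:R)^-1 * \sum_(i < q ^ 2) rnorm (u (x i)) `^ p.
  rewrite big_map big_enum mulr_sumr /=; apply: eq_bigr => i _.
  rewrite linearZ rnormZ real_scalar_norm scalar_re_real ger0_norm // powRM //.
    by rewrite ap.
  exact: (seminorm_ge0 (rnorm_seminorm Z)).
exists s, W; split.
- rewrite size_map size_enum_ord expn_gt0; move: q0; rewrite ltr0n => ->.
  by [].
- move=> phi L f g L0 lf lg fgP; rewrite (sumE (scalars R k)^o).
  have sK := rnorm_seminorm ((scalars R k)^o : normedModType (scalars R k)).
  have Lp : 0 < L + 1 by rewrite ltr_wpDl.
  have term i : rnorm (phi (x i)) `^ p <=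
      (L + 1) `^ (p - 1) * (`|f (x i)| + `|g (x i)|).
    have [_ _ h1 h2] := fgP (x i).
    have t0 : 0 <= rnorm (phi (x i)) := seminorm_ge0 sK _.
    have tL : rnorm (phi (x i)) <= L + 1.
      apply: le_trans h2 _; apply: (@le_trans _ _ L); last by rewrite lerDl.
      by rewrite ler_piMr.
    (* the vectors have norm at most one, so [t ^ p] is at most a multiple of [t] *)
    have -> : rnorm (phi (x i)) `^ p =
        rnorm (phi (x i)) `^ (p - 1) * rnorm (phi (x i)).
      move: t0; rewrite le_eqVlt => /predU1P[<-|t0].
        by rewrite mulr0 powR0.
      rewrite -{3}(powRr1 (ltW t0)) -powRD ?subrK //.
      by rewrite (gt_eqF t0) implybT.
    apply: ler_pM => //; first exact: powR_ge0.
    by apply: ge0_ler_powR; rewrite ?subr_ge0 ?nnegrE // ltW.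
  have sum_le : \sum_(i < q ^ 2) rnorm (phi (x i)) `^ p <=
      (L + 1) `^ (p - 1) * (2 * L * q%:R).
    apply: (@le_trans _ _ (\sum_(i < q ^ 2)
        (L + 1) `^ (p - 1) * (`|f (x i)| + `|g (x i)|))).
      by apply: ler_sum.
    rewrite -mulr_sumr ler_wpM2l ?powR_ge0 // big_split /=.
    have sq : Num.sqrt (q ^ 2)%:R = q%:R :> R.
      by rewrite natrX sqrtr_sqr ger0_norm // ltW.
    have f1 := xweak f L L0 lf (fun z => let: And4 e _ _ _ := fgP z in e).
    have g1 := xweak g L L0 lg (fun z => let: And4 _ e _ _ := fgP z in e).
    by move: f1 g1; rewrite sq; lra.
  rewrite mulrC ler_pdivrMr ?mulr_gt0 //; apply: le_trans sum_le _.
  rewrite exprVn -[leRHS]mulrA mulKf ?gt_eqF //.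
  by rewrite le_eqVlt; apply/orP; left; apply/eqP; ring.
- by move=> v z; have [e _] := WP v; exact: e.
- move=> v u uP; rewrite (sumE Y).
  have [_ card_good] := WP v.
  set good := [pred i | _] in card_good.
  have ulow i : i \in good -> h <= rnorm (u (x i)) `^ p.
    rewrite inE; set y : Y := v (x i) + _ => ylow.
    have uy := uP (x i); rewrite -/y in uy.
    have tri : rnorm y <= rnorm (u (x i)) + rnorm (u (x i) - y).
      have := seminorm_ler sY (u (x i)) (- (u (x i) - y)).
      by rewrite (seminormN sY) opprB addrC subrK.
    have t1 : tail_bound rho n.+1 * rnorm (x i) <= rho ^+ n / 16.
      apply: (@le_trans _ _ (tail_bound rho n.+1)).
        by rewrite ler_piMr // tail_bound_ge0.
      rewrite /tail_bound exprS.
      have : 144 * rho * rho ^+ n <= 1 * rho ^+ n by rewrite ler_wpM2r // ltW.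
      by rewrite mul1r -mulrA; move: (rho ^+ n) (rho * _) => b c; lra.
    apply: ge0_ler_powR; rewrite ?nnegrE ?(ltW p0) //.
    - by rewrite ltW // divr_gt0.
    - exact: (seminorm_ge0 sY).
    - by move: ylow uy tri t1; move: (rho ^+ n) => b; lra.
  have sum_ge : #|good|%:R * h <= \sum_(i < q ^ 2) rnorm (u (x i)) `^ p.
    rewrite mulr_natl -sumr_const big_mkcond; apply: ler_sum => i _.
    by case: ifP => [/ulow //|_]; exact: powR_ge0.
  rewrite mulrC ler_pdivlMr ?mulr_gt0 // mul1r; apply: le_trans sum_ge.
  have card_ge : q%:R ^+ 2 <= 2 * #|good|%:R :> R.
    by rewrite -natrX -natrM ler_nat.
  have q2 : q%:R ^+ 2 * h <= 2 * #|good|%:R * h by rewrite ler_wpM2r // ltW.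
  have q3 : q%:R * (2 * 2 ^+ n) <= q%:R * (q%:R * h) by rewrite ler_wpM2l // ltW.
  by move: q2 q3; rewrite expr2 mulrA; lra.
Qed.

End ScaledBlock.

Theorem corollary2p2 (R : realType) (k : scalar_kind)
    (X Y : completeNormedModType (scalars R k)) (p : R)
    (hX : infinite_dimensional X)
    (hY : no_finite_cotype Y)
    (hp : 1 <= p) :
  exists u : {linear X -> Y}, continuous u /\ ~ p_summing p u.
Proof.
(* so small that all the later blocks cannot undo the effect of a block *)
pose rho : R := 144^-1.
have rho0 : 0 < rho by rewrite invr_gt0.
have rho_small : 144 * rho <= 1 by rewrite /rho; lra.
clearbody rho.
have [S SP] := choice (scaled_block hX hY hp rho0 rho_small).
have {SP}[W SP] := choice SP.
(* the operator of the block [n] depends on the sum of the preceding ones *)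
pose vs := fix vs n : X -> Y := if n is n'.+1 then
  fun x => vs n' x + (real_scalar (rho ^+ n') : scalars R k) *: W n' (vs n') x
  else fun=> 0.
pose w n := W n (vs n).
have wle n x : rnorm (w n x) <= 8 * rnorm x by have [_ _ e _] := SP n; exact: e.
have vsE n x : partial_op rho w n x = vs n x.
  by elim: n => [//|n IHn] /=; rewrite IHn.
have [u [cu uP]] := partial_op_limit rho0 rho_small wle.
(* [0] is the default value of [nth]; it is never reached *)
have S0 n : (0 < size (S n))%N by have [] := SP n.
pose x := concat_seq 0 S.
exists u; split => // /(_ x).
have wx : weak_ell p x.
  move=> phi cphi.
  have [L [f [g [L0 lf lg fgP]]]] := dual_real_parts cphi.
  pose C := 2 * L * (L + 1) `^ (p - 1).
  have C0 : 0 <= C by rewrite mulr_ge0 ?powR_ge0 // mulr_ge0.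
  apply: (@nneseries_bounded R _ (C * 2)) => [j|n]; first exact: powR_ge0.
  apply: (@le_trans _ _ (\sum_(0 <= j < size (concat_blocks S n)) rnorm (phi
    (x j)) `^ p)).
    rewrite [leRHS](big_cat_nat (leq0n n) (leq_size_concat S0 n)) /= lerDl
      sumr_ge0 // => j _.
    exact: powR_ge0.
  rewrite (sum_concat 0 S0 (fun z => rnorm (phi z) `^ p)).
  apply: (@le_trans _ _ (\sum_(i < n) C * 2^-1 ^+ i)).
    apply: ler_sum => i _; have [_ e _ _] := SP i; exact: e fgP.
  rewrite -mulr_sumr ler_wpM2l //.
  suff : \sum_(i < n) 2^-1 ^+ i <= 2 - 2 * 2^-1 ^+ n :> R.
    move/le_trans; apply; rewrite gerBl mulr_ge0 // exprn_ge0 // invr_ge0 //.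
  elim: n => [|n IHn]; first by rewrite big_ord0 mulr1 subrr.
  by rewrite big_ord_recr exprS /=; move: IHn; lra.
(* each block contributes at least one, so the partial sums are unbounded *)
move=> /(_ wx) /nneseries_partial[j|B hB]; first exact: powR_ge0.
have B0 : 0 <= `|B| by [].
have := archi_boundP B0; set n := Num.bound _.
rewrite ltNge => /negP; apply; apply: le_trans (ler_norm B).
apply: le_trans (hB (size (concat_blocks S n))).
rewrite (sum_concat 0 S0 (fun z => rnorm (u z) `^ p)).
have -> : n%:R = \sum_(i < n) (1 : R) by rewrite sumr_const card_ord.
apply: ler_sum => i _; have [_ _ _ e] := SP i; apply: (e (vs i)) => z.
by have := uP i.+1 z; rewrite vsE.
Qed.
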